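(* $$\frac32=\min\Big\{\limsup_{q\to\infty}\frac{p_X(q)}{q} : X\text{ is a subshift which is minimal, infinite, and has no irrational continuous eigenvalue}\Big\}.$$
   Context: A subshift is a closed subset $X\subset\mathcal{A}^{\mathbb{Z}}$ ($\mathcal{A}$ a finite alphabet, product topology) invariant under the left shift homeomorphism $\sigma$; it is minimal if it properly contains no nonempty subshift; $p_X(q)$ is the number of words of length $q$ appearing in points of $X$. A real $\gamma$ is an (additive) continuous eigenvalue of $(X,\sigma)$ if there is a nonzero $f\in C(X)$ with $f(\sigma x)=e^{2\pi i\gamma}f(x)$ for all $x\in X$; it is irrational if $\gamma\notin\mathbb{Q}$. *)

(* Defs.v *)
From mathcomp Require Import all_boot all_order all_algebra.
From mathcomp Require Import all_classical all_reals all_analysis.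
From mathcomp Require Import complex.

Set Implicit Arguments.
Unset Strict Implicit.
Unset Printing Implicit Defensive.

Import Order.TTheory GRing.Theory Num.Theory.
Import numFieldNormedType.Exports.

Local Open Scope classical_set_scope.
Local Open Scope ring_scope.
Local Open Scope complex_scope.

Definition fullshift (A : finType) : topologicalType :=
  {ptws int -> discrete_topology A}.

Definition left_shift (A : finType) (x : fullshift A) : fullshift A :=
  fun n : int => x (n + 1).

Definition subshift (A : finType) (X : set (fullshift A)) : Prop :=
  closed X /\ @left_shift A @` X = X.

Definition minimal_subshift (A : finType) (X : set (fullshift A)) : Prop :=
  subshift X /\
  forall Y : set (fullshift A), subshift Y -> Y !=set0 -> ~ Y `<` X.

Definition words (A : finType) (X : set (fullshift A)) (q : nat) :
    set (q.-tuple A) :=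
  [set w | exists2 x, X x &
     exists i : int, forall j : 'I_q, tnth w j = x (i + (j : nat)%:Z)].
Arguments words [A] X q.

Definition complexity (A : finType) (X : set (fullshift A)) (q : nat) : nat :=
  #|words X q|.

(* [R[i]] carries no topology of its own; seen as a [numFieldType] it gets the
   one given by its modulus. *)
Definition Cplx (R : realType) : numFieldType := R[i].

Definition expi (R : realType) (t : R) : Cplx R := cos t +i* sin t.

Definition continuous_eigenvalue (R : realType) (A : finType)
    (X : set (fullshift A)) (gamma : R) : Prop :=
  exists f : fullshift A -> Cplx R,
    [/\ {within X, continuous f},
        exists2 x, X x & f x != 0 &
        forall x, X x -> f (left_shift x) = expi (2 * pi * gamma) * f x].

(* The limsup is taken in [\bar R], as it may be infinite; the term [q = 0] is
   irrelevant. *)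
Definition limsup_complexity (R : realType) (A : finType)
    (X : set (fullshift A)) : \bar R :=
  limn_esup (fun q : nat => ((complexity X q)%:R / q%:R)%:E).

Definition is_minimum (d : Order.disp_t) (T : porderType d) (S : set T)
    (m : T) : Prop :=
  S m /\ lbound S m.

(* Main.v *)
(** Lower bound.  Let X be minimal and infinite with p(q) <= (3/2 - 1/N) q for large q, and
    x in X.  At a length q with p(q+1) - p(q) = 1 there is one right special word; extending it
    to the left one gets a word W with exactly two returns a, b, so that x is coded by a sequence
    over {a, b}.  Counting right special words shows that the coding can be refined forever: if
    the blocks a^i between two b's had two different positive lengths i, and so had the blocks of
    b's between two a's, then two right special words would coexist for too long.  So, up to
    exchanging a and b, the positive lengths are all equal to some m, and x is coded by b a^m
    and b.  When m >= 2, the block a^m adds (m - 1)|a| to the excess D = |a| + |b| - |W|, and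
    D <= (1/2 - 1/N) q forces |b| >= (m - 2)|a| + 3 D + m|a|/N.

    For suitable integers the intervals with endpoints (integer / |a|) and (integer / |b|) are
    nested; gamma is a common point, and s = gamma |a| - integer, t = integer - gamma |b| measure
    the displacements of the returns.  They satisfy |a| t + |b| s = c, where c is multiplied by m
    at each step, while min(2 |a|, 2 |b|, 3 D) is multiplied by at least m (1 + 1/N) when m >= 2.
    Hence s and t tend to 0, fast enough for gamma r to be uniformly close to integers for all
    return times r of long words: gamma is a continuous eigenvalue, and it is irrational because
    c > 0.

    Sharpness.  Let x(i) be the parity of the largest k such that (k+1)! divides i (and x(0)
    even).  The subshift generated by x has only rational eigenvalues, since the returns to a
    neighbourhood of x include arithmetic progressions, and p(q)/q is largest near q = 2 (k+2)!,
    where p(q) <= (k+1)! + q + (q - (k+2)!). *)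

Require Import Defs.
From mathcomp Require Import all_boot all_order all_algebra.
From mathcomp Require Import all_classical all_reals all_analysis.
From mathcomp Require Import complex.
From mathcomp Require Import zify ring lra.

Set Implicit Arguments.
Unset Strict Implicit.
Unset Printing Implicit Defensive.

Import Order.TTheory GRing.Theory Num.Theory.

Local Open Scope ring_scope.

(** * Two-word codings of a sequence *)

Lemma first_after (P : int -> Prop) i e : e < i -> P i ->
  exists p, [/\ e < p, P p & forall k, e < k -> k < p -> ~ P k].
Proof.
move=> ei Pi; pose Q (n : nat) := `[< (0 < n)%N /\ P (e + n%:Z) >].
have hQ : exists n, Q n.
  exists (absz (i - e)); apply/asboolP; split; first lia.
  by have -> : e + (absz (i - e))%:Z = i by lia.
case: (ex_minnP hQ) => n /asboolP [n0 hn] hmin; exists (e + n%:Z); split=> //; first lia.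
move=> k k1 k2 hk; have : Q (absz (k - e)).
  apply/asboolP; split; first lia.
  by have -> : e + (absz (k - e))%:Z = k by lia.
by move=> /hmin; lia.
Qed.

Lemma last_before (P : int -> Prop) i e : i < e -> P i ->
  exists p, [/\ p < e, P p & forall k, p < k -> k < e -> ~ P k].
Proof.
move=> ie Pi; have [||p [p1 p2 p3]] := @first_after (fun k => P (- k)) (- i) (- e).
- by rewrite ltrN2.
- by rewrite opprK.
exists (- p); split=> //; first by rewrite ltrNl.
by move=> k k1 k2 hk; apply: (p3 (- k)); rewrite ?opprK //; lia.
Qed.

Section Agreement.
Variables (A : finType) (x : int -> A).

Definition agree (i j a b : int) : Prop :=
  forall t, a <= t -> t < b -> x (i + t) = x (j + t).

Lemma agree_at i j a b k l : agree i j a b -> k - i = l - j ->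
  a <= k - i -> k - i < b -> x k = x l.
Proof.
move=> h e h1 h2; have := h _ h1 h2.
have -> : i + (k - i) = k by lia.
by have -> : j + (k - i) = l by lia.
Qed.

Lemma agree_refl i a b : agree i i a b.
Proof. by []. Qed.

Lemma agree_sym i j a b : agree i j a b -> agree j i a b.
Proof. by move=> h t h1 h2; rewrite h. Qed.

Lemma agree_trans j i k a b : agree i j a b -> agree j k a b -> agree i k a b.
Proof. by move=> h h' t h1 h2; rewrite h ?h'. Qed.

Lemma agree_sub a b i j a' b' :
  agree i j a b -> a <= a' -> b' <= b -> agree i j a' b'.
Proof. by move=> h h1 h2 t h3 h4; apply: h; lia. Qed.

Lemma agree_shift s i j i' j' a b a' b' : agree i j a b ->
  i' = i + s -> j' = j + s -> a <= a' + s -> b' + s <= b -> agree i' j' a' b'.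
Proof. by move=> h -> -> ? ? t ? ?; apply: (agree_at h); lia. Qed.

Lemma agree_cat b i j a c : agree i j a b -> agree i j b c -> agree i j a c.
Proof.
move=> h h' t h1 h2; case: (ltP t b) => h3; [exact: h | exact: h'].
Qed.

(* A state codes x by the occurrences of the word W of length sq at position sa.
   W also occurs at sb, and is followed there by a different letter.  Occurrences
   of W followed by the same letter as at sa (resp. sb) are those of [occa]
   (resp. [occb]); the next occurrence of W is then su (resp. sv) further on. *)
Record state := State { sq : int; sa : int; sb : int; su : int; sv : int }.

Definition occ s j := agree j (sa s) 0 (sq s).
Definition occa s j := agree j (sa s) 0 (sq s + 1).
Definition occb s j := agree j (sb s) 0 (sq s + 1).

Record wf s : Prop := Wf {
  wf_q : 0 <= sq s;
  wf_u : 0 < su s;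
  wf_v : 0 < sv s;
  wf_ab : agree (sa s) (sb s) 0 (sq s);
  wf_neq : x (sa s + sq s) <> x (sb s + sq s);
  wf_occ : forall j, occ s j -> occa s j \/ occb s j;
  wf_a : forall j, occa s j -> agree j (sa s) 0 (sq s + su s);
  wf_b : forall j, occb s j -> agree j (sb s) 0 (sq s + sv s);
  wf_sau : occ s (sa s + su s);
  wf_sbv : occ s (sb s + sv s);
  wf_agap : forall t, 0 < t -> t < su s -> ~ occ s (sa s + t);
  wf_bgap : forall t, 0 < t -> t < sv s -> ~ occ s (sb s + t);
  wf_last : x (sa s + su s - 1) <> x (sb s + sv s - 1) }.

Definition swap s := State (sq s) (sb s) (sa s) (sv s) (su s).

Lemma occ_swap s : wf s -> forall j, occ (swap s) j <-> occ s j.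
Proof.
move=> w j; split=> h.
  exact: agree_trans h (agree_sym (wf_ab w)).
exact: agree_trans h (wf_ab w).
Qed.

Lemma swapK s : swap (swap s) = s.
Proof. by case: s. Qed.

Lemma wf_swap s : wf s -> wf (swap s).
Proof.
move=> w; have e := occ_swap w; case: (w) => *; split=> //=.
- exact: agree_sym.
- by move=> h; apply: (wf_neq w).
- move=> j /e /(wf_occ w) []; [by right | by left].
- exact/e.
- exact/e.
- by move=> t h1 h2 /e; apply: (wf_bgap w).
- by move=> t h1 h2 /e; apply: (wf_agap w).
- by move=> h; apply: (wf_last w).
Qed.

Lemma occa_occ s j : occa s j -> occ s j.
Proof. by move=> h; apply: (agree_sub h); lia. Qed.

Lemma occb_occ s j : wf s -> occb s j -> occ s j.
Proof. by move=> w h; apply/(occ_swap w)/(@occa_occ (swap s)). Qed.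

Lemma occa_occb s j : wf s -> occa s j -> occb s j -> False.
Proof.
move=> w ha hb; apply: (wf_neq w); have q0 := wf_q w.
by rewrite -(ha (sq s)) ?(hb (sq s)) //; lia.
Qed.

Lemma occ_a s j : occ s j -> x (j + sq s) = x (sa s + sq s) -> occa s j.
Proof.
move=> h e; apply: (agree_cat h) => t h1 h2.
by have -> : t = sq s by lia.
Qed.

Lemma occ_b s j : wf s -> occ s j -> x (j + sq s) = x (sb s + sq s) -> occb s j.
Proof. by move=> w /(occ_swap w) h e; apply: (@occ_a (swap s)). Qed.

Lemma nexta s j : wf s -> occa s j -> occ s (j + su s).
Proof.
move=> w /(wf_a w) h; apply: (agree_trans _ (wf_sau w)).
by apply: (agree_shift h) => //; have := wf_u w; lia.
Qed.

Lemma nextb s j : wf s -> occb s j -> occ s (j + sv s).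
Proof. by move=> w h; apply/(occ_swap w)/(@nexta (swap s))/h/wf_swap. Qed.

Lemma gapa s j k : wf s -> occa s j -> j < k -> k < j + su s -> ~ occ s k.
Proof.
move=> w /(wf_a w) h h1 h2 h3.
apply: (wf_agap w (t := k - j)); [lia | lia |].
apply: (agree_trans _ h3); apply: agree_sym; apply: (agree_shift h (s := k - j)); lia.
Qed.

Lemma gapb s j k : wf s -> occb s j -> j < k -> k < j + sv s -> ~ occ s k.
Proof.
move=> w h h1 h2 /(occ_swap w).
by apply: (@gapa (swap s) j k) => //; apply: wf_swap.
Qed.

Lemma lasta s j : wf s -> occa s j -> x (j + su s - 1) = x (sa s + su s - 1).
Proof.
move=> w /(wf_a w) h; have := wf_u w; have := wf_q w => ? ?.
apply: (agree_at h); lia.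
Qed.

Lemma lastb s j : wf s -> occb s j -> x (j + sv s - 1) = x (sb s + sv s - 1).
Proof. by move=> w h; apply: (@lasta (swap s)) h; apply: wf_swap. Qed.

(* A Fine-Wilf argument: otherwise both periods su and sv fit into the word and
   the letters that follow its two extensions coincide. *)
Lemma wf_excess s : wf s -> sq s < su s + sv s.
Proof.
move=> w; have u0 := wf_u w; have v0 := wf_v w; have q0 := wf_q w.
case: (ltP (sq s) (su s + sv s)) => // h; case: (wf_neq w).
have ha := wf_sau w; have hb := wf_sbv w; have hab := wf_ab w.
have -> : x (sa s + sq s) = x (sa s + (sq s - su s)) by apply: (agree_at ha); lia.
have -> : x (sa s + (sq s - su s)) = x (sb s + (sq s - su s))
  by apply: (agree_at hab); lia.
have -> : x (sb s + (sq s - su s)) = x (sa s + (sq s - su s - sv s))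
  by apply: (agree_at hb); lia.
have -> : x (sb s + sq s) = x (sa s + (sq s - sv s)) by apply: (agree_at hb); lia.
by apply/esym; apply: (agree_at ha); lia.
Qed.

Definition run s j (r : nat) : Prop :=
  (forall t : nat, (t < r)%N -> occa s (j + t%:Z * su s)) /\
  occb s (j + r%:Z * su s).

Lemma run0 s j : run s j 0 <-> occb s j.
Proof. by rewrite /run mul0r addr0; split=> [[]|]. Qed.

Lemma runS s j r : run s j r.+1 <-> occa s j /\ run s (j + su s) r.
Proof.
split=> [[h1 h2]|[h0 [h1 h2]]].
  split; first by have := h1 0%N isT; rewrite mul0r addr0.
  split; last first.
    by have -> : j + su s + r%:Z * su s = j + r.+1%:Z * su s by lia.
  move=> t ht; have -> : j + su s + t%:Z * su s = j + t.+1%:Z * su s by lia.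
  exact: h1.
split; last first.
  by have <- : j + su s + r%:Z * su s = j + r.+1%:Z * su s by lia.
case=> [|t] ht; first by rewrite mul0r addr0.
have <- : j + su s + t%:Z * su s = j + t.+1%:Z * su s by lia.
exact: h1.
Qed.

Lemma run_gap s j r k : wf s -> run s j r -> j <= k -> k < j + r%:Z * su s ->
  occ s k -> occa s k /\ exists t : nat, (t < r)%N /\ k = j + t%:Z * su s.
Proof.
move=> w; elim: r j => [|r IH] j; first by lia.
move=> /runS [h0 h1] h2 h3 h4.
case: (ltP k (j + su s)) => h5; last first.
  have h3' : k < j + su s + r%:Z * su s by lia.
  case: (IH _ h1 h5 h3' h4) => ? [t [ht e]]; split=> //.
  by exists t.+1; split=> //; lia.
have e : k = j.
  have [//|ne] := eqVneq k j; exfalso; apply: (gapa w h0 _ h5 h4); lia.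
by rewrite e; split=> //; exists 0%N; split=> //; lia.
Qed.

Lemma run_agree s j k r : wf s -> run s j r -> run s k r ->
  agree j k 0 (r%:Z * su s + sq s).
Proof.
move=> w; elim: r j k => [|r IH] j k.
  move=> /run0 h /run0 h'; rewrite mul0r add0r.
  by apply: (agree_trans (occb_occ w h)); apply/agree_sym/(occb_occ w h').
move=> /runS [h1 h2] /runS [h3 h4].
have h5 : agree j k 0 (su s).
  have q0 := wf_q w.
  by apply: (agree_trans (j := sa s)); [|apply: agree_sym];
     apply: (agree_sub (wf_a w _)) => //; lia.
apply: (agree_cat h5); apply: (agree_shift (IH _ _ h2 h4) (s := - su s)); lia.
Qed.

(* Each maximal block of returns of type a has length m.  The word of s' is the
   return of type b extended by W; its returns are b a^m and b. *)
Record astep s (m : nat) s' : Prop := AStep {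
  as_m : (0 < m)%N;
  as_run : forall j, occb s j -> run s (j + sv s) 0 \/ run s (j + sv s) m;
  as_q : sq s' = sq s + sv s;
  as_u : su s' = sv s + m%:Z * su s;
  as_v : sv s' = sv s;
  as_ba : occb s (sa s');
  as_ra : run s (sa s' + sv s) m;
  as_bb : occb s (sb s');
  as_rb : run s (sb s' + sv s) 0 }.

Section Step.
Variables (s s' : state) (m : nat).
Hypotheses (w : wf s) (st : astep s m s').

Lemma occ_step j : occ s' j <-> occb s j.
Proof.
have v0 := wf_v w; rewrite /occ (as_q st); split=> h.
  apply: (agree_trans _ (as_ba st)); apply: (agree_sub h); lia.
apply: (agree_trans (wf_b w h)); exact: agree_sym (wf_b w (as_ba st)).
Qed.

Lemma occa_step j : occa s' j <-> occb s j /\ run s (j + sv s) m.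
Proof.
have v0 := wf_v w; have u0 := wf_u w; have q0 := wf_q w; split.
  move=> h; have hb : occb s j by apply/occ_step/occa_occ.
  split=> //; case: (as_run st hb) => // /run0 h'.
  case: (m) (as_m st) (as_ra st) => // r _ /runS [h'' _].
  case: (occa_occb w (j := j + sv s)) => //.
  apply: (agree_trans _ h'').
  apply: (agree_shift h); rewrite ?(as_q st) //; lia.
move=> [hb hr]; rewrite /occa (as_q st).
apply: (agree_cat (b := sv s)).
  apply: (agree_trans (j := sb s)); [|apply: agree_sym].
    by apply: (agree_sub (wf_b w hb)); lia.
  by apply: (agree_sub (wf_b w (as_ba st))); lia.
have h := run_agree w hr (as_ra st).
apply: (agree_shift h (s := - sv s)); [lia|lia|lia|].
by have := as_m st; case: (m) => // r _; lia.
Qed.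

Lemma occb_step j : occb s' j <-> occb s j /\ occb s (j + sv s).
Proof.
have v0 := wf_v w; have u0 := wf_u w; have q0 := wf_q w.
have e : agree (sa s') (sb s') 0 (sq s + sv s).
  apply: (agree_trans (wf_b w (as_ba st))).
  exact: agree_sym (wf_b w (as_bb st)).
have /run0 rb := as_rb st.
split.
  move=> h; have hb : occb s j.
    apply/occ_step; rewrite /occ (as_q st); apply: (agree_trans _ (agree_sym e)).
    by apply: (agree_sub h); rewrite ?(as_q st); lia.
  split=> //; apply: (agree_trans _ rb).
  by apply: (agree_shift h); rewrite ?(as_q st) //; lia.
move=> [hb hr]; rewrite /occb (as_q st).
apply: (agree_cat (b := sv s)).
  apply: (agree_trans (j := sb s)); [|apply: agree_sym].
    by apply: (agree_sub (wf_b w hb)); lia.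
  by apply: (agree_sub (wf_b w (as_bb st))); lia.
have h := agree_trans hr (agree_sym rb).
apply: (agree_shift h (s := - sv s)); lia.
Qed.

Lemma wf_step : wf s'.
Proof.
have v0 := wf_v w; have u0 := wf_u w; have q0 := wf_q w.
have mu : 0 < m%:Z * su s by have := as_m st; case: (m) => // r _; lia.
have oab j : occb s j -> run s (j + sv s) 0 \/ run s (j + sv s) m := as_run st (j:=j).
have [sbb /run0 sbv] := (as_bb st, as_rb st).
have [sab sav] := (as_ba st, as_ra st).
split.
- rewrite (as_q st); lia.
- rewrite (as_u st); lia.
- by rewrite (as_v st).
- rewrite (as_q st); apply: (agree_trans (wf_b w sab)).
  exact: agree_sym (wf_b w sbb).
- rewrite (as_q st) => e.
  case: (m) (as_m st) sav => // r _ /runS [ha _].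
  case: (occa_occb w ha); apply: (occ_b w); first exact: occa_occ.
  have -> : sa s' + sv s + sq s = sa s' + (sq s + sv s) by lia.
  by rewrite e; apply: (agree_at sbv); lia.
- move=> j /occ_step h; case: (oab _ h) => [/run0|] h'.
    by right; apply/occb_step.
  by left; apply/occa_step.
- move=> j /occa_step [hb hr]; rewrite (as_q st) (as_u st).
  apply: (agree_cat (b := sv s)).
    apply: (agree_trans (j := sb s)); [|apply: agree_sym].
      by apply: (agree_sub (wf_b w hb)); lia.
    by apply: (agree_sub (wf_b w sab)); lia.
  have [_ hr1] := hr; have [_ hr2] := sav.
  apply: (agree_cat (b := sv s + m%:Z * su s)).
    by apply: (agree_shift (run_agree w hr sav) (s := - sv s)); lia.
  have h := agree_trans (wf_b w hr1) (agree_sym (wf_b w hr2)).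
  by apply: (agree_shift h (s := - (sv s + m%:Z * su s))); lia.
- move=> j /occb_step [hb hr]; rewrite (as_q st) (as_v st).
  apply: (agree_cat (b := sv s)).
    apply: (agree_trans (j := sb s)); [|apply: agree_sym].
      by apply: (agree_sub (wf_b w hb)); lia.
    by apply: (agree_sub (wf_b w sbb)); lia.
  have h := agree_trans (wf_b w hr) (agree_sym (wf_b w sbv)).
  apply: (agree_shift h (s := - sv s)); lia.
- by apply/occ_step; rewrite (as_u st) addrA; case: sav.
- by apply/occ_step; rewrite (as_v st).
- move=> t t0; rewrite (as_u st) => t1 /occ_step hb.
  have ho := occb_occ w hb.
  case: (ltP t (sv s)) => h1; first by apply: (gapb w sab _ _ ho); lia.
  have [|| ha _] := run_gap w sav _ _ ho; [lia|lia|].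
  exact: (occa_occb w ha hb).
- move=> t t0; rewrite (as_v st) => t1 /occ_step hb.
  by apply: (gapb w sbb _ _ (occb_occ w hb)); lia.
- rewrite (as_u st) (as_v st) => e; apply: (wf_last w).
  rewrite -(lastb w sbb) -e.
  case: (m) (as_m st) sav => // r _ [ha _].
  rewrite -(lasta w (ha r _)) //; congr x; lia.
Qed.

End Step.
End Agreement.

Section Recurrence.
Variables (A : finType) (x : int -> A).
Local Notation agree := (agree x).
Local Notation occ := (occ x).
Local Notation occa := (occa x).
Local Notation occb := (occb x).
Local Notation run := (run x).
Local Notation wf := (wf x).

Definition recurrent := forall i n, exists L, forall t,
  exists j, [/\ t <= j, j < t + L & agree j i 0 n].
Definition not_right_periodic := forall i P, 0 < P ->
  ~ (forall t, i <= t -> x (t + P) = x t).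

Hypotheses (Hrec : recurrent) (Hap : not_right_periodic).

Lemma rec_window i a b : exists L, forall t,
  exists j, [/\ t <= j, j < t + L & agree j i a b].
Proof.
have [L HL] := Hrec (i + a) (b - a); exists L => t.
have [j [h1 h2 h3]] := HL (t + a); exists (j - a); split; [lia|lia|].
by apply: (agree_shift h3 (s := - a)); lia.
Qed.

Lemma periodic_absurd (B : int -> Prop) j P : 0 < P -> B j ->
  (forall k, B k -> B (k + P) /\ agree (k + P) k 0 P) -> False.
Proof.
move=> P0 Bj HB; apply: (Hap P0 (i := j)) => t jt.
have BB (n : nat) : B (j + n%:Z * P).
  elim: n => [|n IH]; first by rewrite mul0r addr0.
  have -> : j + n.+1%:Z * P = j + n%:Z * P + P by lia.
  by case: (HB _ IH).
suff H (n : nat) : forall t, j <= t -> t < j + n%:Z * P -> x (t + P) = x t.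
  apply: (H (absz (t - j + 1))) => //; nia.
elim: n => [|n IH] k h1 h2; first lia.
case: (ltP k (j + n%:Z * P)) => h3; first exact: IH.
by have [_ h] := HB _ (BB n); apply: (agree_at h); lia.
Qed.

Lemma run_exists s j : wf s -> occ s j -> exists r, run s j r.
Proof.
move=> w hj.
have [/asboolP h|/asboolPn h] := boolP `[< forall t : nat, occa s (j + t%:Z * su s) >].
  exfalso; apply: (@periodic_absurd
    (fun k => exists t : nat, k = j + t%:Z * su s) j (su s)).
  - exact: wf_u w.
  - by exists 0%N; lia.
  - move=> k [t ->]; split; first by exists t.+1; lia.
    have -> : j + t%:Z * su s + su s = j + t.+1%:Z * su s by lia.
    apply: (agree_trans (j := sa s)); [|apply: agree_sym];
      by apply: (agree_sub (wf_a w (h _))) => //; have := wf_q w; lia.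
have h' : exists t : nat, ~~ `[< occa s (j + t%:Z * su s) >].
  by move/existsNP: h => [t ht]; exists t; apply/asboolPn.
case: (ex_minnP h') => r /asboolPn hr hmin; exists r.
have hl (t : nat) : (t < r)%N -> occa s (j + t%:Z * su s).
  by move=> tr; apply/asboolP; apply: contraTT tr => /hmin; rewrite -leqNgt.
split=> //.
have ho : occ s (j + r%:Z * su s).
  case: r {hr hmin} hl => [|r] hl; first by rewrite mul0r addr0.
  have -> : j + r.+1%:Z * su s = j + r%:Z * su s + su s by lia.
  exact/(nexta w)/hl.
by case: (wf_occ w ho).
Qed.

Lemma special_depth s n : wf s -> 0 <= n ->
  exists j j', [/\ occa s j, occb s j' & agree j j' (- n) 0].
Proof.
move=> w n0; apply: contrapT => hno.
have det j j' : occ s j -> occ s j' -> agree j j' (- n) 0 ->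
    (occa s j /\ occa s j') \/ (occb s j /\ occb s j').
  move=> h h' ha; case: (wf_occ w h); case: (wf_occ w h') => h1 h2.
  - by left.
  - by case: hno; exists j, j'.
  - by case: hno; exists j', j; split=> //; apply: agree_sym.
  - by right.
have u0 := wf_u w; have v0 := wf_v w; have q0 := wf_q w.
have fwd (m : nat) : forall j j', occ s j -> occ s j' -> agree j j' (- n) 0 ->
    agree j j' 0 m%:Z.
  elim: m => [|m IH] j j' h h' ha; first by move=> t; lia.
  have step l : 0 < l -> occ s (j + l) -> occ s (j' + l) -> agree j j' 0 l ->
      agree j j' 0 m.+1%:Z.
    move=> l0 ho ho' hl.
    have hl' : agree (j + l) (j' + l) (- n) 0.
      by apply: (agree_shift (agree_cat ha hl) (s := l)); lia.
    apply: (agree_cat hl).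
    by apply: (agree_shift (IH _ _ ho ho' hl') (s := - l)); lia.
  case: (det _ _ h h' ha) => -[h1 h2].
    apply: (step (su s)) => //; [exact: nexta|exact: nexta|].
    apply: (agree_trans (j := sa s)); [|apply: agree_sym];
      by apply: (agree_sub (wf_a w _)) => //; lia.
  apply: (step (sv s)) => //; [exact: nextb|exact: nextb|].
  apply: (agree_trans (j := sb s)); [|apply: agree_sym];
    by apply: (agree_sub (wf_b w _)) => //; lia.
have [L HL] := rec_window (sa s) (- n) (sq s).
have [j [h1 _ h3]] := HL (sa s + 1).
have oj : occ s j by apply: (agree_sub h3); lia.
have osa : occ s (sa s) by apply: agree_refl.
have ha : agree j (sa s) (- n) 0 by apply: (agree_sub h3); lia.
apply: (Hap (i := sa s) (P := j - sa s)); first lia.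
move=> t ht; have h := fwd (absz (t - sa s + 1)) _ _ oj osa ha.
by apply: (agree_at h); lia.
Qed.

Definition aruns s r := exists j, [/\ occb s j, run s (j + sv s) r & (0 < r)%N].

Lemma aruns_exists s : wf s -> exists r, aruns s r.
Proof.
move=> w; have w' := wf_swap w.
have [|r [h1 h2]] := @run_exists (swap s) (sb s) w'; first exact: agree_refl.
have hb : occb s (sb s) by apply: agree_refl.
case: r h1 h2 => [|r] h1 h2.
  by case: (occa_occb w (j := sb s)) => //; rewrite /= mul0r addr0 in h2.
have hr : occb s (sb s + r%:Z * sv s) := h1 r (ltnSn r).
have ha : occa s (sb s + r%:Z * sv s + sv s).
  by have -> : sb s + r%:Z * sv s + sv s = sb s + r.+1%:Z * sv s by lia.
have [r' hr'] := run_exists w (occa_occ ha).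
exists r', (sb s + r%:Z * sv s); split=> //.
by case: r' hr' => // /run0 /(occa_occb w ha).
Qed.

Lemma astep_exists s : wf s -> (forall r r', aruns s r -> aruns s r' -> r = r') ->
  exists m s', astep x s m s'.
Proof.
move=> w hu; have [m hm] := aruns_exists w.
have all j : occb s j -> run s (j + sv s) 0 \/ run s (j + sv s) m.
  move=> hj; have [[|r] hr] := run_exists w (nextb w hj); first by left.
  by right; rewrite (hu m r.+1) //; exists j.
have [jb [hb1 hb2]] : exists j, occb s j /\ run s (j + sv s) 0.
  apply: contrapT => hno.
  have all' j : occb s j -> run s (j + sv s) m.
    by move=> hj; case: (all _ hj) => // h; case: hno; exists j.
  have u0 := wf_u w; have v0 := wf_v w; have q0 := wf_q w.
  apply: (@periodic_absurd (occb s) (sb s) (sv s + m%:Z * su s)).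
  - nia.
  - exact: agree_refl.
  - move=> k hk; have hr := all' _ hk; have [_ h] := hr.
    rewrite addrA; split=> //.
    apply: (agree_cat (b := sv s)).
      apply: (agree_trans (j := sb s)); [|apply: agree_sym];
        by apply: (agree_sub (wf_b w _)) => //; lia.
    have h' := run_agree w (all' _ h) hr.
    by apply: (agree_shift h' (s := - sv s)); lia.
case: hm => ja [ha1 ha2 ha3].
by exists m, (State (sq s + sv s) ja jb (sv s + m%:Z * su s) (sv s)); split.
Qed.

(* Some right special word has W as a suffix, exceeds it by d letters and ends
   with a return of type a. *)
Definition special_a s d := exists j j',
  [/\ occa s j, occb s j', agree j j' (- d) 0 & x (j - 1) = x (sa s + su s - 1)].

Lemma arun_agree s j k (r : nat) : wf s ->
  (forall t : nat, (t < r)%N -> occa s (j + t%:Z * su s)) ->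
  (forall t : nat, (t < r)%N -> occa s (k + t%:Z * su s)) ->
  agree j k 0 (r%:Z * su s).
Proof.
move=> w; elim: r => [|r IH] hj hk; first by move=> t; lia.
have u0 := wf_u w; have q0 := wf_q w.
apply: (agree_cat (IH _ _)).
- by move=> t ht; apply: hj; lia.
- by move=> t ht; apply: hk; lia.
have h : agree (j + r%:Z * su s) (k + r%:Z * su s) 0 (sq s + su s).
  apply: (agree_trans (wf_a w (hj _ (ltnSn r)))).
  exact: agree_sym (wf_a w (hk _ (ltnSn r))).
by apply: (agree_shift h (s := - (r%:Z * su s))); lia.
Qed.

Lemma special_a_fork s r r' : wf s -> aruns s r -> aruns s r' -> (r < r')%N ->
  special_a s (su s + sv s).
Proof.
move=> w [k [hk [ha hb] r0]] [k' [hk' [ha' hb'] r0']] rr.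
have u0 := wf_u w; have v0 := wf_v w; have q0 := wf_q w.
exists (k' + sv s + r%:Z * su s), (k + sv s + r%:Z * su s); split.
- exact: ha'.
- exact: hb.
- have h1 : agree k' k 0 (sv s).
    apply: (agree_trans (j := sb s)); [|apply: agree_sym];
      by apply: (agree_sub (wf_b w _)) => //; lia.
  have h2 : agree (k' + sv s) (k + sv s) 0 (r%:Z * su s).
    by apply: (arun_agree w) => // t ht; apply: ha'; lia.
  have h : agree k' k 0 (sv s + r%:Z * su s).
    by apply: (agree_cat h1); apply: (agree_shift h2 (s := - sv s)); lia.
  apply: (agree_shift h (s := sv s + r%:Z * su s)); [lia|lia| |lia].
  by case: (r) r0 => // r1 _; nia.
- case: (r) r0 rr => // r1 _ rr.
  by rewrite -(lasta w (ha' r1 _)); [congr x|]; lia.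
Qed.

Lemma special_a_step s m s' : wf s -> astep x s m s' -> (1 < m)%N ->
  special_a s (m.-1%:Z * su s).
Proof.
move=> w st m1; have [ha hb] := as_ra st.
have u0 := wf_u w.
exists (sa s' + sv s + m.-1%:Z * su s), (sa s' + sv s + m%:Z * su s); split=> //.
- by apply: ha; lia.
- have h : agree (sa s' + sv s) (sa s' + sv s + su s) 0 (m.-1%:Z * su s).
    apply: (arun_agree w) => t ht; first by apply: ha; lia.
    have -> : sa s' + sv s + su s + t%:Z * su s = sa s' + sv s + t.+1%:Z * su s.
      lia.
    by apply: ha; lia.
  by apply: (agree_shift h (s := m.-1%:Z * su s)); case: (m) m1 => // r _; lia.
- case: (m) m1 ha => [|[|r]] // _ ha.
  by rewrite -(lasta w (ha r _)); [congr x|]; lia.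
Qed.

End Recurrence.

(** * Counting right special words *)

Section Counting.
Variables (A : finType) (x : int -> A).
Local Notation agree := (agree x).

(* The word of length [n] that ends just before position [e]. *)
Definition past (e : int) (n : nat) : n.-tuple A :=
  [tuple x (e - n%:Z + (i : nat)%:Z) | i < n].

Definition factors n : {set n.-tuple A} := [set w | `[< exists e, w = past e n >]].

Definition right_special n : {set n.-tuple A} :=
  [set w | `[< exists e e', [/\ w = past e n, w = past e' n & x e <> x e'] >]].

Definition nfactors n := #|factors n|.
Definition nspecial n := #|right_special n|.

Lemma pastP e e' n : past e n = past e' n <-> agree e e' (- n%:Z) 0.
Proof.
split=> [h t h1 h2|h].
  have tn : (absz (t + n%:Z)%R < n)%N by lia.
  have /(congr1 (fun w => tnth w (Ordinal tn))) := h.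
  rewrite !tnth_mktuple /= => e1.
  have -> : e + t = e - n%:Z + (absz (t + n%:Z))%:Z by lia.
  by rewrite e1; congr x; lia.
apply: eq_from_tnth => i; rewrite !tnth_mktuple.
by have := ltn_ord i => hi; apply: (agree_at h); lia.
Qed.

Definition wbelast n (w : n.+1.-tuple A) : n.-tuple A :=
  [tuple tnth w (widen_ord (leqnSn n) i) | i < n].

Lemma wbelast_past e n : wbelast (past e n.+1) = past (e - 1) n.
Proof.
apply: eq_from_tnth => i; rewrite !tnth_mktuple /=; congr x; lia.
Qed.

Lemma past_last e n : tnth (past e n.+1) ord_max = x (e - 1).
Proof. by rewrite tnth_mktuple /=; congr x; lia. Qed.

Lemma past_eqS e e' n : past e n.+1 = past e' n.+1 <->
  past (e - 1) n = past (e' - 1) n /\ x (e - 1) = x (e' - 1).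
Proof.
rewrite !pastP; split=> [h|[h1 h2] t ta tb].
  split; last by apply: (agree_at h); lia.
  by apply: (agree_shift h (s := - 1)); lia.
have [->|ne] := eqVneq t (- 1) => //.
by apply: (agree_at h1); lia.
Qed.

Lemma complexityS n : exists B : {set n.+1.-tuple A},
  #|factors n.+1| = (#|factors n| + #|B|)%N /\
  exists c : n.-tuple A -> A, forall e,
    past e n.+1 \in B <-> x (e - 1) <> c (past (e - 1) n).
Proof.
pose E (w : n.-tuple A) : int :=
  match pselect (exists e, w = past e n) with
  | left h => projT1 (cid h) | right _ => 0 end.
have HE w : w \in factors n -> past (E w) n = w.
  rewrite finset.inE => /asboolP h; rewrite /E; case: pselect => // h'.
  by case: (cid h').
pose c w := x (E w).
pose B := [set w in factors n.+1 | tnth w ord_max != c (wbelast w)].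
pose C := [set w in factors n.+1 | tnth w ord_max == c (wbelast w)].
exists B; split; last first.
  exists c => e; rewrite finset.inE past_last wbelast_past; split.
    by case/andP=> _ /eqP.
  by move=> h; apply/andP; split; [rewrite finset.inE; apply/asboolP; exists e | apply/eqP].
have -> : factors n.+1 = C :|: B.
  apply/setP => w; rewrite !finset.inE -andb_orr.
  by case: eqP => _; rewrite ?andbT ?orbT ?andbT.
have -> : #|C :|: B| = (#|C| + #|B|)%N.
  rewrite cardsU; have -> : C :&: B = finset.set0; last by rewrite cards0 subn0.
  by apply/setP => w; rewrite !finset.inE; case: eqP => _; rewrite ?andbF.
congr (_ + _)%N; have inj : {in C &, injective (@wbelast n)}.
  move=> w w'; rewrite !finset.inE => /andP[/asboolP [e ->] /eqP h1].
  move=> /andP[/asboolP [e' ->] /eqP h2] h3.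
  move: h1 h2; rewrite h3 !past_last => h1 h2.
  apply/past_eqS; split; last by rewrite h1 h2.
  by rewrite -!wbelast_past.
rewrite -(card_in_imset inj); apply: eq_card => w; apply/imsetP/idP.
  move=> [w']; rewrite finset.inE => /andP[]; rewrite finset.inE => /asboolP [e ->] _ ->.
  by rewrite wbelast_past finset.inE; apply/asboolP; exists (e - 1).
move=> hw; exists (past (E w + 1) n.+1).
  rewrite finset.inE; apply/andP; split; first by rewrite finset.inE; apply/asboolP; eexists.
  by rewrite past_last wbelast_past addrK HE // /c eqxx.
by rewrite wbelast_past addrK HE.
Qed.

Lemma complexity_special n : (nfactors n + nspecial n <= nfactors n.+1)%N.
Proof.
rewrite /nfactors /nspecial.
have [B [-> [c HB]]] := complexityS n; rewrite leq_add2l.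
apply: leq_trans (leq_imset_card (@wbelast n) B); apply: subset_leq_card.
apply/fintype.subsetP => w; rewrite finset.inE => /asboolP [e [e' [h1 h2 h3]]].
apply/imsetP; have [hc|hc] := eqVneq (x e) (c w).
  exists (past (e' + 1) n.+1); last by rewrite wbelast_past addrK.
  by apply/HB; rewrite addrK -h2 -hc => h; apply: h3.
exists (past (e + 1) n.+1); last by rewrite wbelast_past addrK.
by apply/HB; rewrite addrK -h1; apply/eqP.
Qed.

Section UniqueSpecial.
Variable n : nat.
Hypothesis Hn : (nfactors n.+1 <= (nfactors n).+1)%N.

Lemma unique_special e e' f f' : agree e e' (- n%:Z) 0 -> x e <> x e' ->
  agree f f' (- n%:Z) 0 -> x f <> x f' -> agree e f (- n%:Z) 0.
Proof.
have [B [hB [c HB]]] := complexityS n.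
have : (#|B| <= 1)%N by rewrite -(leq_add2l #|factors n|) -hB addn1.
move=> /card_le1P hB1.
have pick g g' : agree g g' (- n%:Z) 0 -> x g <> x g' ->
    exists g0, past g0 n = past g n /\ past (g0 + 1) n.+1 \in B.
  move=> /pastP h1 h2; have [hc|hc] := eqVneq (x g) (c (past g n)).
    exists g'; split=> //; apply/HB; rewrite addrK -h1 -hc => h; exact: h2.
  by exists g; split=> //; apply/HB; rewrite addrK; apply/eqP.
move=> h1 h2 h3 h4; have [e0 [e1 e2]] := pick _ _ h1 h2.
have [f0 [f1 f2]] := pick _ _ h3 h4.
apply/pastP; rewrite -e1 -f1.
have /(_ (past (f0 + 1) n.+1)) := hB1 _ e2; rewrite f2 finset.inE => /esym/eqP.
by move=> /past_eqS []; rewrite !addrK.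
Qed.

Lemma two_extensions e e' e'' : agree e e' (- n%:Z) 0 -> agree e e'' (- n%:Z) 0 ->
  x e <> x e' -> x e'' = x e \/ x e'' = x e'.
Proof.
have [B [hB [c HB]]] := complexityS n.
have : (#|B| <= 1)%N by rewrite -(leq_add2l #|factors n|) -hB addn1.
move=> /card_le1P hB1 /pastP h1 /pastP h2 h3.
have same g g' : past g n = past g' n -> x g <> c (past g n) -> x g' <> c (past g' n) ->
    x g = x g'.
  move=> hg h4 h5.
  have b1 : past (g + 1) n.+1 \in B by apply/HB; rewrite addrK.
  have b2 : past (g' + 1) n.+1 \in B by apply/HB; rewrite addrK.
  have := hB1 _ b1 (past (g' + 1) n.+1); rewrite b2 finset.inE => /esym/eqP.
  by move=> /past_eqS []; rewrite !addrK.
have [hc|/eqP hc] := eqVneq (x e) (c (past e n)).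
  have [hc'|/eqP hc'] := eqVneq (x e'') (c (past e n)).
    by left; rewrite hc hc'.
  right; apply: same; first by rewrite -h1 -h2.
    by rewrite -h2.
  by rewrite -h1 -hc => h; apply: h3.
have [hc'|/eqP hc'] := eqVneq (x e'') (c (past e n)).
  have [hc''|/eqP hc''] := eqVneq (x e') (c (past e n)).
    by right; rewrite hc' hc''.
  by case: h3; apply: same => //; rewrite -h1.
by left; apply/esym; apply: same => //; rewrite -h2.
Qed.

End UniqueSpecial.

(* Right special words that are neither a suffix of the word of the state nor
   have it as a suffix. *)
Definition stray s n : {set n.-tuple A} :=
  [set w | `[< exists e e', [/\ w = past e n, w = past e' n, x e <> x e' &
    ~ agree e (sa s + sq s) (- Num.min n%:Z (sq s)) 0] >]].

Definition nstray s n := #|stray s n|.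

Lemma stray_special s n : stray s n \subset right_special n.
Proof.
apply/fintype.subsetP => w; rewrite !finset.inE => /asboolP [e [e' [h1 h2 h3 _]]].
by apply/asboolP; exists e, e'.
Qed.

Lemma card_special_gt s n (S : {set n.-tuple A}) w :
  stray s n \subset S -> w \in S -> w \notin stray s n -> (#|stray s n| < #|S|)%N.
Proof.
move=> h1 h2 h3; apply: proper_card; apply/properP; split=> //; by exists w.
Qed.

Lemma notin_stray s n e : agree e (sa s + sq s) (- Num.min n%:Z (sq s)) 0 ->
  past e n \notin stray s n.
Proof.
move=> h; apply/negP; rewrite finset.inE => /asboolP [f [f' [/pastP h1 _ _ h2]]].
apply: h2; apply: (agree_trans (j := e)) => //.
by apply/agree_sym/(agree_sub h1); lia.
Qed.

Hypotheses (Hrec : recurrent x) (Hap : not_right_periodic x).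

Lemma occ_end s j n : occ x s j -> 0 <= sq s ->
  agree (j + sq s) (sa s + sq s) (- Num.min n%:Z (sq s)) 0.
Proof. by move=> h q0; apply: (agree_shift h (s := sq s)); lia. Qed.

Lemma special_past s j j' d (n : nat) : wf x s -> occa x s j -> occb x s j' ->
  agree j j' (- d) 0 -> n%:Z <= sq s + d -> past (j + sq s) n \in right_special n.
Proof.
move=> w h1 h2 h3 h4; rewrite finset.inE; apply/asboolP.
have o1 := occa_occ h1; have o2 := occb_occ w h2; have q0 := wf_q w.
exists (j + sq s), (j' + sq s); split=> //.
  apply/pastP.
  have h : agree j j' (- d) (sq s).
    by apply: (agree_cat h3); exact: agree_trans o1 (agree_sym o2).
  by apply: (agree_shift h (s := sq s)); lia.
have -> : x (j + sq s) = x (sa s + sq s) by apply: (agree_at h1); lia.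
have -> : x (j' + sq s) = x (sb s + sq s) by apply: (agree_at h2); lia.
exact: wf_neq w.
Qed.

Lemma special_gt_stray s n : wf x s -> (nstray s n < nspecial n)%N.
Proof.
move=> w; have [|j [j' [h1 h2 h3]]] := special_depth Hrec Hap w (n := n%:Z) => //.
have q0 := wf_q w.
apply: (card_special_gt (w := past (j + sq s) n)).
- exact: stray_special.
- by apply: (special_past w h1 h2 h3); lia.
- exact/notin_stray/occ_end/q0/occa_occ.
Qed.

Lemma stray_swap s n : wf x s -> stray (swap s) n = stray s n.
Proof.
move=> w; apply/setP => w'; rewrite !finset.inE.
have h : agree (sa s + sq s) (sb s + sq s) (- sq s) 0.
  by apply: (agree_shift (wf_ab w) (s := sq s)); lia.
apply/asbool_equiv_eq; split=> -[e [e' [h1 h2 h3 h4]]]; exists e, e'; split=> //= h5;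
  apply: h4; apply: (agree_trans h5).
  by apply: (agree_sub h); rewrite /=; lia.
by apply/agree_sym/(agree_sub h); lia.
Qed.

Lemma special_fork s n d d' : wf x s -> special_a x s d -> special_a x (swap s) d' ->
  sq s < n%:Z -> n%:Z <= sq s + d -> n%:Z <= sq s + d' ->
  ((nstray s n).+2 <= nspecial n)%N.
Proof.
move=> w [j [j' [h1 h2 h3 h4]]] [k [k' [g1 g2 g3 g4]]] n1 n2 n3.
have q0 := wf_q w; have w' := wf_swap w.
have m1 : past (k + sq s) n \in right_special n.
  exact: (special_past w' g1 g2 g3).
have m2 : past (j + sq s) n \in right_special n.
  exact: (special_past w h1 h2 h3).
have s1 : past (k + sq s) n \notin stray s n.
  rewrite -stray_swap //; apply: notin_stray.
  exact: (occ_end (n := n) (occa_occ g1) q0).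
have s2 : past (j + sq s) n \notin stray s n.
  exact/notin_stray/occ_end/q0/occa_occ.
have ne : past (j + sq s) n != past (k + sq s) n.
  apply/eqP => /pastP h; apply: (wf_last w); rewrite -h4 -[RHS]g4.
  by apply: (agree_at h); lia.
have := card_special_gt (s := s) (S := right_special n :\ past (k + sq s) n)
  (w := past (j + sq s) n).
rewrite /nspecial (cardsD1 (past (k + sq s) n) (right_special n)) m1 add1n ltnS; apply => //.
  apply/fintype.subsetP => z hz; rewrite in_setD1 (fintype.subsetP (stray_special s n)) //.
  by rewrite andbT; apply: contraNneq s1 => <-.
by rewrite in_setD1 ne.
Qed.

Lemma stray_step s m s' n : wf x s -> astep x s m s' ->
  stray s n \subset stray s' n.
Proof.
move=> w st; have w' := wf_step w st.
apply/fintype.subsetP => z; rewrite !finset.inE => /asboolP [e [e' [h1 h2 h3 h4]]].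
apply/asboolP; exists e, e'; split=> // h5; apply: h4.
have q0 := wf_q w; have v0 := wf_v w.
apply: (agree_trans (j := sa s' + sq s')).
  by apply: (agree_sub h5); rewrite ?(as_q st); lia.
have ho : occ x s (sa s' + sv s) by apply: (nextb w); exact: (as_ba st).
rewrite (as_q st) [sq s + _]addrC addrA; exact: occ_end.
Qed.

Lemma stray_step_gt s m s' n d : wf x s -> astep x s m s' -> special_a x s d ->
  sq s < n%:Z -> n%:Z <= sq s + d -> (nstray s n < nstray s' n)%N.
Proof.
move=> w st [j [j' [h1 h2 h3 h4]]] n1 n2; have q0 := wf_q w; have v0 := wf_v w.
apply: (card_special_gt (w := past (j + sq s) n)).
- exact: (stray_step _ w st).
- have := special_past w h1 h2 h3 n2; rewrite !finset.inE => /asboolP [e [e' [g1 g2 g3]]].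
  apply/asboolP; exists e, e'; split=> // h; apply: (wf_last w); rewrite -h4.
  have -> : x (j - 1) = x (e - sq s - 1) by move/pastP: g1 => g1; apply: (agree_at g1); lia.
  rewrite -(lastb w (as_ba st)); move: h; rewrite (as_q st) => h.
  by apply: (agree_at h); lia.
- exact/notin_stray/occ_end/q0/occa_occ.
Qed.

Variable q0 : nat.

Definition stray_sum s (Q : nat) := (\sum_(q0 <= n < Q) nstray s n)%N.

Lemma complexity_stray s (Q : nat) : wf x s -> (q0 <= Q)%N ->
  (nfactors q0 + (Q - q0) + stray_sum s Q <= nfactors Q)%N.
Proof.
move=> w; elim: Q => [|Q IH] h.
  have -> : q0 = 0%N by lia.
  by rewrite /stray_sum big_geq // addn0 subnn addn0.
have [e|ne] := eqVneq q0 Q.+1.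
  by rewrite -e /stray_sum big_geq // subnn !addn0.
have h' : (q0 <= Q)%N by lia.
have := IH h'; rewrite /stray_sum big_nat_recr //=.
have := complexity_special Q; have := special_gt_stray Q w; lia.
Qed.

Lemma complexity_fork s d (Q : nat) : wf x s -> special_a x s d ->
  special_a x (swap s) d -> q0%:Z <= sq s -> 0 <= d -> sq s + d < Q%:Z ->
  (nfactors q0)%:Z + (Q%:Z - q0%:Z) + (stray_sum s Q)%:Z + d <= (nfactors Q)%:Z.
Proof.
move=> w ha hb hq d0 hQ.
suff H (k : nat) : (q0 <= k)%N -> (nfactors q0)%:Z + (k%:Z - q0%:Z) + (stray_sum s k)%:Z
    + Num.max 0 (Num.min d (k%:Z - sq s - 1)) <= (nfactors k)%:Z.
  by have := H Q; lia.
elim: k => [|k IH] h.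
  have -> : q0 = 0%N by lia.
  by rewrite /stray_sum big_geq //; lia.
have [e|ne] := eqVneq q0 k.+1.
  by rewrite -e /stray_sum big_geq //; lia.
have h' : (q0 <= k)%N by lia.
have := IH h'; rewrite /stray_sum big_nat_recr //= => H.
have h1 := complexity_special k; have h2 := special_gt_stray k w.
case: (ltP (sq s) k%:Z) => c1; last lia.
case: (leP k%:Z (sq s + d)) => c2; last lia.
have := special_fork w ha hb c1 c2 c2; lia.
Qed.

Lemma stray_sum_step s m s' (Q : nat) : wf x s -> astep x s m s' ->
  (stray_sum s Q <= stray_sum s' Q)%N.
Proof.
move=> w st; apply: leq_sum => n _; exact/subset_leq_card/(stray_step _ w st).
Qed.

Lemma stray_sum_gain s m s' d (Q : nat) : wf x s -> astep x s m s' -> special_a x s d ->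
  0 <= d -> q0%:Z <= sq s -> sq s + d < Q%:Z ->
  (stray_sum s Q)%:Z + d <= (stray_sum s' Q)%:Z.
Proof.
move=> w st ha d0 hq hQ.
suff H (k : nat) : (q0 <= k)%N -> (stray_sum s k)%:Z
    + Num.max 0 (Num.min d (k%:Z - sq s - 1)) <= (stray_sum s' k)%:Z.
  by have := H Q; lia.
elim: k => [|k IH] h.
  by rewrite /stray_sum !big_geq //; lia.
have [e|ne] := eqVneq q0 k.+1.
  by rewrite -e /stray_sum !big_geq //; lia.
have h' : (q0 <= k)%N by lia.
have := IH h'; rewrite /stray_sum !big_nat_recr //= => H.
have h2 : (nstray s k <= nstray s' k)%N := subset_leq_card (stray_step k w st).
case: (ltP (sq s) k%:Z) => c1; last lia.
case: (leP k%:Z (sq s + d)) => c2; last lia.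
have := stray_step_gt w st ha c1 c2; lia.
Qed.

End Counting.

(** * The hierarchy of codings *)

Section Initial.
Variables (A : finType) (x : int -> A).
Local Notation agree := (agree x).
Hypotheses (Hrec : recurrent x) (Hap : not_right_periodic x).

Lemma special_exists (n : nat) : exists e e', agree e e' (- n%:Z) 0 /\ x e <> x e'.
Proof.
apply: contrapT => hno.
have det e e' : agree e e' (- n%:Z) 0 -> x e = x e'.
  by move=> h; apply: contrapT => h'; apply: hno; exists e, e'.
have fwd (m : nat) : forall e e', agree e e' (- n%:Z) 0 -> agree e e' 0 m%:Z.
  elim: m => [|m IH] e e' h; first by move=> t; lia.
  have h1 : agree e e' (- n%:Z) 1.
    apply: (agree_cat h) => t t0 t1; have -> : t = 0 by lia.
    by rewrite !addr0; exact: det.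
  apply: (agree_cat (b := 1)); first by apply: (agree_sub h1); lia.
  have h2 : agree (e + 1) (e' + 1) (- n%:Z) 0 by apply: (agree_shift h1 (s := 1)); lia.
  by apply: (agree_shift (IH _ _ h2) (s := -1)); lia.
have [L HL] := rec_window Hrec 0 (- n%:Z) 0.
have [j [h1 _ h3]] := HL 1.
apply: (Hap (i := 0) (P := j)); first lia.
move=> t ht; have h := fwd (absz (t + 1)) _ _ h3.
by apply: (agree_at h); lia.
Qed.

Lemma not_left_periodic i P : 0 < P -> ~ (forall t, t <= i -> x (t + P) = x t).
Proof.
move=> P0 h; apply: (Hap (i := 0) (P := P) P0) => t _.
have [L HL] := Hrec t (P + 1).
have [j [h1 h2 h3]] := HL (i - L).
have -> : x (t + P) = x (j + P) by apply/esym/(agree_at h3); lia.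
have -> : x t = x j by apply/esym/(agree_at h3); lia.
by apply: h; lia.
Qed.

Variable q1 : nat.
Hypothesis Hq1 : (nfactors x q1.+1 <= (nfactors x q1).+1)%N.

Section WithSpecial.
Variables (e1 e2 : int).
Hypotheses (h12 : agree e1 e2 (- q1%:Z) 0) (n12 : x e1 <> x e2).

Let R e := agree e e1 (- q1%:Z) 0.

Lemma R_letter e : R e -> x e = x e1 \/ x e = x e2.
Proof. by move=> h; apply: (two_extensions Hq1 h12 _ n12); apply: agree_sym. Qed.

Lemma R_unique f f' : agree f f' (- q1%:Z) 0 -> ~ R f -> x f = x f'.
Proof.
move=> h hn; apply: contrapT => h'; apply: hn.
exact/agree_sym/(unique_special Hq1 h12 n12 h h').
Qed.

Lemma R_forward (l : nat) f f' : agree f f' (- q1%:Z) 0 ->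
  (forall t, 0 <= t -> t < l%:Z -> ~ R (f + t)) -> agree f f' (- q1%:Z) l%:Z.
Proof.
move=> h; elim: l => [|l IH] hn //.
have h' : agree f f' (- q1%:Z) l%:Z by apply: IH => t t0 t1; apply: hn; lia.
apply: (agree_cat h') => t t0 t1; have -> : t = l%:Z by lia.
apply: R_unique; last by apply: hn; lia.
by apply: (agree_shift h' (s := l%:Z)); lia.
Qed.

Lemma R_return e : exists u : nat, [/\ (0 < u)%N, R (e + u%:Z) &
  forall t, 0 < t -> t < u%:Z -> ~ R (e + t)].
Proof.
have [L HL] := rec_window Hrec e1 (- q1%:Z) 0.
have [j [h1 _ h3]] := HL (e + 1).
have [||p [p1 p2 p3]] := @first_after R j e; [lia | exact: h3 |].
exists (absz (p - e)); split; first lia.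
  by have -> : e + (absz (p - e))%:Z = p by lia.
by move=> t t0 t1; apply: p3; lia.
Qed.

Lemma R_block e e0 (u : nat) : R e0 -> (forall t, 0 < t -> t < u%:Z -> ~ R (e0 + t)) ->
  (0 < u)%N -> R e -> x e = x e0 -> agree e e0 (- q1%:Z) u%:Z.
Proof.
move=> r0 hu u0 he hx.
have h1 : agree e0 e (- q1%:Z) 1.
  apply: (agree_cat (agree_trans r0 (agree_sym he))) => t t0 t1.
  have -> : t = 0 by lia.
  by rewrite !addr0.
have h2 : agree (e0 + 1) (e + 1) (- q1%:Z) 0 by apply: (agree_shift h1 (s := 1)); lia.
have h3 : agree (e0 + 1) (e + 1) (- q1%:Z) u.-1%:Z.
  apply: R_forward => // t t0 t1.
  have -> : e0 + 1 + t = e0 + (1 + t) by lia.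
  by apply: hu; lia.
apply/agree_sym/(agree_cat h1); apply: (agree_shift h3 (s := -1)); lia.
Qed.

Lemma R_left : exists h : nat, (forall e, R e -> agree e e1 (- q1%:Z - h%:Z) 0) /\
  exists2 e, R e & x (e - q1%:Z - h%:Z - 1) <> x (e1 - q1%:Z - h%:Z - 1).
Proof.
pose P (h : nat) := `[< forall e, R e -> agree e e1 (- q1%:Z - h%:Z) 0 >].
have hP : exists h, ~~ P h.
  apply: contrapT => /forallNP hno.
  have [u [u0 hu _]] := R_return e1.
  apply: (@not_left_periodic (e1 - 1) u%:Z) => // t ht.
  have := hno (absz (e1 - t)); move=> /negP; rewrite negbK => /asboolP /(_ _ hu) h.
  by apply: (agree_at h); lia.
case: (ex_minnP hP) => -[|h] hh hmin.
  by case/negP: hh; apply/asboolP => e he; apply: (agree_sub he); lia.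
have hPh : forall e, R e -> agree e e1 (- q1%:Z - h%:Z) 0.
  by apply/asboolP; apply/negPn/negP => /hmin; lia.
exists h; split=> //.
move/asboolPn: hh => /existsNP [e /not_implyP [he hn]]; exists e => // heq; apply: hn.
apply: (agree_cat (b := - q1%:Z - h%:Z)); last exact: hPh.
move=> t t0 t1; have -> : t = - q1%:Z - h%:Z - 1 by lia.
by rewrite !addrA.
Qed.

End WithSpecial.

(* The right special word R of length q1 is unique; the word of the state is the
   longest left extension of R that is common to all occurrences of R. *)
Lemma state_exists : exists s, [/\ wf x s, q1%:Z <= sq s &
  su s + sv s - 1 <= (nfactors x (absz (sq s)))%:Z].
Proof.
have [e1 [e2 [h12 n12]]] := special_exists q1.
pose R e := agree e e1 (- q1%:Z) 0.
have R1 : R e1 by [].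
have R2 : R e2 by apply: agree_sym.
have [u [u0 hu gu]] := R_return e1 e1.
have [v [v0 hv gv]] := R_return e1 e2.
have [h [hR [e3 he3 ne3]]] := R_left e1.
pose q := q1%:Z + h%:Z.
have hRq e : R e -> agree e e1 (- q) 0 by move=> /hR he; apply: (agree_sub he); lia.
have bu e : R e -> x e = x e1 -> agree e e1 (- q) u%:Z.
  move=> he hx; have hb := R_block h12 n12 R1 gu u0 he hx.
  by apply: (agree_cat (hRq _ he)); apply: (agree_sub hb); lia.
have bv e : R e -> x e = x e2 -> agree e e2 (- q) v%:Z.
  move=> he hx; have hb := R_block h12 n12 R2 gv v0 he hx.
  apply: (agree_cat (agree_trans (hRq _ he) (agree_sym (hRq _ R2)))).
  by apply: (agree_sub hb); lia.
pose s := State q (e1 - q) (e2 - q) u%:Z v%:Z.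
have oR j : occ x s j <-> R (j + q).
  split=> [ho|/hRq ho]; first by apply: (agree_shift ho (s := q)); rewrite /=; lia.
  by apply: (agree_shift ho (s := - q)); rewrite /=; lia.
have oa j : occa x s j <-> R (j + q) /\ x (j + q) = x e1.
  split=> [ho|[/oR ho hx]].
    split; first by apply/oR/occa_occ.
    by apply: (agree_at ho); rewrite /=; lia.
  by apply: (occ_a ho); rewrite /= hx; congr x; lia.
have ob j : occb x s j <-> R (j + q) /\ x (j + q) = x e2.
  split=> [ho|[/oR ho hx]].
    split; last by apply: (agree_at ho); rewrite /=; lia.
    apply: (agree_trans _ R2).
    by apply: (agree_shift ho (s := q)); rewrite /=; lia.
  have ha : agree j (e2 - q) 0 q.
    apply: (agree_trans ho) => /=.
    by apply/agree_sym/(agree_shift (hRq _ R2) (s := - q)); lia.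
  apply: (agree_cat ha) => t t0 t1 /=; have -> : t = q by move: t0 t1 => /=; lia.
  by rewrite hx; congr x; lia.
have last : x (e1 + u%:Z - q - 1) <> x (e2 + v%:Z - q - 1).
  move=> hx; have hlast e : R e -> x (e - q - 1) = x (e1 + u%:Z - q - 1).
    move=> he; have [L HL] := rec_window Hrec e1 (- q1%:Z) 0.
    have [i0 [i1 i2 i3]] := HL (e - L).
    have [||p [p1 hn hno]] := @last_before R i0 e; [lia | exact: i3 |].
    pose n := absz (e - p).
    have pE : p = e - n%:Z by lia.
    rewrite pE in hn hno.
    case: (R_letter h12 n12 hn) => hx'.
      have hb := bu _ hn hx'.
      have en : n%:Z = u%:Z.
        case: (ltgtP n u) => [c|c|->] //; exfalso.
          apply: (gu n%:Z); [lia|lia|].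
          apply: agree_trans _ he; apply: agree_sym.
          by apply: (agree_shift hb (s := n%:Z)); lia.
        apply: (hno (e - n%:Z + u%:Z)); [lia|lia|].
        apply: agree_trans _ hu.
        by apply: (agree_shift hb (s := u%:Z)); lia.
      by apply: (agree_at hb); lia.
    have hb := bv _ hn hx'.
    have en : n%:Z = v%:Z.
      case: (ltgtP n v) => [c|c|->] //; exfalso.
        apply: (gv n%:Z); [lia|lia|].
        apply: agree_trans _ he; apply: agree_sym.
        by apply: (agree_shift hb (s := n%:Z)); lia.
      apply: (hno (e - n%:Z + v%:Z)); [lia|lia|].
      apply: agree_trans _ hv.
      by apply: (agree_shift hb (s := v%:Z)); lia.
    by rewrite hx; apply: (agree_at hb); lia.
  have := hlast _ he3; rewrite -(hlast _ R1) => h'; apply: ne3.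
  have -> : e3 - q1%:Z - h%:Z - 1 = e3 - q - 1 by lia.
  by rewrite h'; congr x; lia.
have w : wf x s.
  split=> //=.
  - by apply: (agree_shift (agree_sym (hRq _ R2)) (s := - q)); lia.
  - by rewrite !subrK.
  - move=> j /oR hj; case: (R_letter h12 n12 hj) => hx; [left|right].
      exact/oa.
    exact/ob.
  - move=> j /oa [hj hx]; apply: (agree_shift (bu _ hj hx) (s := - q)); lia.
  - move=> j /ob [hj hx]; apply: (agree_shift (bv _ hj hx) (s := - q)); lia.
  - by apply/oR; have -> : e1 - q + u%:Z + q = e1 + u%:Z by lia.
  - by apply/oR; have -> : e2 - q + v%:Z + q = e2 + v%:Z by lia.
  - move=> t t0 t1 /oR; have -> : e1 - q + t + q = e1 + t by lia.
    exact: gu.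
  - move=> t t0 t1 /oR; have -> : e2 - q + t + q = e2 + t by lia.
    exact: gv.
  - have -> : e1 - q + u%:Z - 1 = e1 + u%:Z - q - 1 by lia.
    by have -> : e2 - q + v%:Z - 1 = e2 + v%:Z - q - 1 by lia.
exists s; split=> //=; first lia.
have dist e e' t t' (l l' : nat) : (forall k, 0 < k -> k < l%:Z -> ~ R (e + k)) ->
    (forall k, 0 < k -> k < l'%:Z -> ~ R (e' + k)) -> R (e + l%:Z) -> R (e' + l'%:Z) ->
    0 < t -> t <= l%:Z -> 0 < t' -> t' <= l'%:Z ->
    agree (e + t) (e' + t') (- q) 0 ->
    l%:Z - t = l'%:Z - t' /\ agree (e + l%:Z) (e' + l'%:Z) (- q - (l%:Z - t)) 0.
  move=> g g' r r' t0 t1 t0' t1' ha.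
  have ha1 : agree (e + t) (e' + t') (- q1%:Z) 0 by apply: (agree_sub ha); lia.
  have eq : l%:Z - t = l'%:Z - t'.
    case: (ltgtP (l%:Z - t) (l'%:Z - t')) => // c; exfalso.
      have [||] := g' (t' + (l%:Z - t)); [lia|lia|].
      apply: agree_trans _ r; apply: agree_sym.
      have hff : agree (e + t) (e' + t') (- q1%:Z) (absz (l%:Z - t))%:Z.
        apply: (R_forward h12 n12 ha1) => k k0 k1.
        have -> : e + t + k = e + (t + k) by lia.
        by apply: g; lia.
      by apply: (agree_shift hff (s := l%:Z - t)); lia.
    have [||] := g (t + (l'%:Z - t')); [lia|lia|].
    apply: agree_trans _ r'; apply: agree_sym.
    have hff : agree (e' + t') (e + t) (- q1%:Z) (absz (l'%:Z - t'))%:Z.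
      apply: (R_forward h12 n12 (agree_sym ha1)) => k k0 k1.
      have -> : e' + t' + k = e' + (t' + k) by lia.
      by apply: g'; lia.
    by apply: (agree_shift hff (s := l'%:Z - t')); lia.
  split=> //.
  have hff : agree (e + t) (e' + t') (- q1%:Z) (absz (l%:Z - t))%:Z.
    apply: (R_forward h12 n12 ha1) => k k0 k1.
    have -> : e + t + k = e + (t + k) by lia.
    by apply: g; lia.
  have hf2 : agree (e + t) (e' + t') (- q) (absz (l%:Z - t))%:Z.
    by apply: (agree_cat ha); apply: (agree_sub hff); lia.
  by apply: (agree_shift hf2 (s := l%:Z - t)); lia.
pose Q := absz q.
have qQ : q = Q%:Z by lia.
pose f (k : 'I_(u + v).-1) : Q.-tuple A :=
  if (k < u)%N then past x (e1 + k.+1%:Z) Q else past x (e2 + (k - u).+1%:Z) Q.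
have inj : injective f.
  move=> k k'; rewrite /f; have lk := ltn_ord k; have lk' := ltn_ord k'.
  case: ltnP => c; case: ltnP => c' /pastP; rewrite -qQ => ha; apply: val_inj => /=.
  - have [||||h1 h2] := dist _ _ _ _ _ _ gu gu hu hu _ _ _ _ ha; lia.
  - exfalso; have [||||h1 h2] := dist _ _ _ _ _ _ gu gv hu hv _ _ _ _ ha; try lia.
    by apply: last; apply: (agree_at h2); lia.
  - exfalso; have [||||h1 h2] := dist _ _ _ _ _ _ gv gu hv hu _ _ _ _ ha; try lia.
    by apply: last; apply/esym/(agree_at h2); lia.
  - have [||||h1 h2] := dist _ _ _ _ _ _ gv gv hv hv _ _ _ _ ha; lia.
have : (#|f @: 'I_(u + v).-1| <= nfactors x Q)%N.
  apply: subset_leq_card; apply/fintype.subsetP => z /imsetP [k _ ->].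
  rewrite finset.inE; apply/asboolP; rewrite /f.
  by case: ifP => _; eexists.
rewrite card_imset // card_ord.
have -> : (q1 + h)%N = Q by lia.
lia.
Qed.

End Initial.

Section Hierarchy.
Variables (A : finType) (x : int -> A).
Hypotheses (Hrec : recurrent x) (Hap : not_right_periodic x).
Variables (N q0 : nat).
Hypotheses (N4 : (4 <= N)%N) (q0N : (3 * N <= q0)%N).
Hypothesis Hp : forall Q, (q0 <= Q)%N ->
  (2 * N * nfactors x Q <= (3 * N - 2) * Q)%N.

Definition excess s := su s + sv s - sq s.

(* [good_inv] is the bound p(Q) >= Q + excess s - 1 for Q >= K: by then, the right
   special words that branched off earlier have all died out. *)
Record good s K : Prop := Good {
  good_wf : wf x s;
  good_q : q0%:Z <= sq s;
  good_inv : forall Q : nat, (q0 <= Q)%N -> K <= Q%:Z ->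
    Q%:Z + excess s - 1 <= (nfactors x q0)%:Z + (Q%:Z - q0%:Z) + (stray_sum x q0 s Q)%:Z;
  good_K : K <= 2 * excess s + Num.min (su s) (sv s) - 2 }.

Lemma good_swap s K : good s K -> good (swap s) K.
Proof.
case=> w h1 h2 h3; split=> //.
- exact: wf_swap.
- move=> Q hQ hK; have := h2 Q hQ hK.
  have -> : stray_sum x q0 (swap s) Q = stray_sum x q0 s Q.
    by apply: eq_bigr => n _; rewrite /nstray stray_swap.
  rewrite /excess /=; lia.
- by rewrite /excess /=; move: h3; rewrite /excess; lia.
Qed.

Definition strong_bound s (m : nat) : Prop :=
  m%:Z * su s <= N%:Z * (sv s - (m%:Z - 2) * su s - 3 * excess s).

Definition link s m s' := astep x s m s' /\ ((1 < m)%N -> strong_bound s m).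

Definition successor s m s' := link s m s' \/ link (swap s) m (swap s').

Lemma bound_at (Q : nat) e : (q0 <= Q)%N -> Q%:Z + e - 1 <= (nfactors x Q)%:Z ->
  2 * Q%:Z <= N%:Z * (Q%:Z - 2 * e + 2) /\ 0 < Q%:Z - 2 * e + 2.
Proof.
move=> h1 h2; have h3 := Hp h1.
have h4 : N%:Z * (Q%:Z + e - 1) <= N%:Z * (nfactors x Q)%:Z by apply: ler_wpM2l.
have h5 : 2 * Q%:Z <= N%:Z * (Q%:Z - 2 * e + 2).
  have {}h3 : 2 * (N%:Z * (nfactors x Q)%:Z) <= 3 * (N%:Z * Q%:Z) - 2 * Q%:Z.
    have h6 : ((3 * N - 2) * Q = 3 * (N * Q) - 2 * Q)%N by rewrite mulnBl mulnA.
    have h7 : (2 * Q <= 3 * (N * Q))%N by rewrite mulnA; apply: leq_mul => //; lia.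
    by move: h3; rewrite h6 -mulnA -!PoszM; lia.
  by move: h4 h3; rewrite !mulrDr; lia.
split=> //; rewrite -(pmulr_rgt0 _ (x := N%:Z)); last lia.
by apply: lt_le_trans h5; lia.
Qed.

Lemma good_astep s K m s' : good s K -> astep x s m s' ->
  exists K', good s' K' /\ ((1 < m)%N -> strong_bound s m).
Proof.
move=> g st; have w := good_wf g; have w' := wf_step w st.
have u0 := wf_u w; have v0 := wf_v w; have sq0 := wf_q w; have D0 := wf_excess w.
have gq := good_q g.
have gq' : q0%:Z <= sq s' by rewrite (as_q st); lia.
have [m1|m1] := leqP m 1.
  have em : m = 1%N by have := as_m st; lia.
  have eE : excess s' = excess s.
    by rewrite /excess (as_u st) (as_v st) (as_q st) em; lia.
  exists K; split; last by rewrite em.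
  split=> //.
    move=> Q hQ hK; have := good_inv g hQ hK; rewrite eE.
    have := stray_sum_step q0 Q w st; lia.
  have := good_K g; rewrite eE (as_u st) (as_v st) em; lia.
have sp := special_a_step w st m1.
have eE : excess s' = excess s + m.-1%:Z * su s.
  rewrite /excess (as_u st) (as_v st) (as_q st); case: (m) m1 => // k _; lia.
have mu : su s <= m.-1%:Z * su s by case: (m) m1 => [|[]] // k _; nia.
pose K' := sq s + m.-1%:Z * su s + 1.
have inv (Q : nat) : (q0 <= Q)%N -> K <= Q%:Z -> K' <= Q%:Z ->
    Q%:Z + excess s' - 1 <= (nfactors x q0)%:Z + (Q%:Z - q0%:Z) + (stray_sum x q0 s' Q)%:Z.
  move=> h1 h2 h3; have := good_inv g h1 h2; rewrite eE.
  have := stray_sum_gain w st sp (Q := Q); rewrite /K' in h3.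
  by move=> /(_ q0) H; have := H _ _ _; lia.
have key (Q : nat) : (q0 <= Q)%N -> K <= Q%:Z -> K' <= Q%:Z ->
    2 * Q%:Z <= N%:Z * (Q%:Z - 2 * excess s' + 2) /\ 0 < Q%:Z - 2 * excess s' + 2.
  move=> h1 h2 h3; apply: bound_at => //; apply: (le_trans (inv Q h1 h2 h3)).
  have := complexity_stray Hrec Hap w' h1; lia.
have gK := good_K g.
have eK : K <= K'.
  rewrite leNgt; apply/negP => c.
  have c' : sq s + m.-1%:Z * su s + 1 < K by [].
  have K0 : (absz K)%:Z = K by lia.
  have c1 : (q0 <= absz K)%N by lia.
  have [|||_] := key (absz K); rewrite ?K0 ?eE //; first exact: ltW.
  by move: gK; rewrite /excess; lia.
exists K'; split.
  split=> //.
    by move=> Q h1 h2; apply: inv => //; lia.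
  by rewrite eE (as_u st) (as_v st) /K' /excess; lia.
move=> _; have K0 : (absz K')%:Z = K' by rewrite /K'; lia.
have [|||H _] := key (absz K'); rewrite ?K0 //; try by rewrite /K'; lia.
rewrite /strong_bound; set y := sv s - _ - _.
have ey : K' - 2 * excess s' + 2 = y + 3.
  by rewrite eE /K' /y /excess; case: (m) m1 => // k _; lia.
move: H; rewrite K0 ey mulrDr /K'.
have : m%:Z * su s <= 2 * (m.-1%:Z * su s) by case: (m) m1 mu => // k _; lia.
lia.
Qed.

Lemma aruns_two s : wf x s -> (forall m s', ~ astep x s m s') ->
  special_a x s (su s + sv s).
Proof.
move=> w hno; apply: contrapT => hs.
have [r r' h1 h2|m [s' st]] := astep_exists Hap w.
  case: (ltngtP r r') => // c; case: hs.
    exact: (special_a_fork w h1 h2 c).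
  exact: (special_a_fork w h2 h1 c).
exact: hno st.
Qed.

(* Otherwise both types of blocks have two positive lengths, and two right special
   words end with W at all lengths up to sq + su + sv, which is too many. *)
Lemma good_next s K : good s K -> exists m s' K', successor s m s' /\ good s' K'.
Proof.
move=> g; have w := good_wf g.
have [[m [s' st]]|/forallNP h1] := pselect (exists m s', astep x s m s').
  have [K' [g' sb]] := good_astep g st.
  by exists m, s', K'; split=> //; left.
have [[m [s' st]]|/forallNP h2] := pselect (exists m s', astep x (swap s) m s').
  have [K' [g' sb]] := good_astep (good_swap g) st.
  exists m, (swap s'), K'; split; last exact: good_swap.
  by right; rewrite swapK.
exfalso.
have sa : special_a x s (su s + sv s).
  by apply: aruns_two => // m s' st; apply: (h1 m); exists s'.
have sb : special_a x (swap s) (su s + sv s).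
  rewrite addrC; apply: (@aruns_two (swap s)); first exact: wf_swap.
  by move=> m s' st; apply: (h2 m); exists s'.
have u0 := wf_u w; have v0 := wf_v w; have sq0 := wf_q w; have D0 := wf_excess w.
have gq := good_q g; have gK := good_K g.
have key (Q : nat) : (q0 <= Q)%N -> K <= Q%:Z -> sq s + (su s + sv s) < Q%:Z ->
    0 < Q%:Z - 2 * (excess s + (su s + sv s)) + 2.
  move=> k1 k2 k3; have [//||//] := @bound_at Q (excess s + (su s + sv s)).
  have := good_inv g k1 k2.
  have := complexity_fork Hrec Hap w sa sb gq _ k3; lia.
rewrite /excess in gK key.
have [c|c] := leP K (sq s + (su s + sv s) + 1).
  have := key (absz (sq s + (su s + sv s) + 1)); lia.
have := key (absz K); lia.
Qed.

Lemma hierarchy_exists s0 K0 : good s0 K0 ->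
  exists (S : nat -> state) (M : nat -> nat),
    [/\ S 0%N = s0, forall k, exists K, good (S k) K & forall k, successor (S k) (M k) (S k.+1)].
Proof.
move=> g0.
pose T := {s : state | exists K, good s K}.
have step (t : T) : {mt : nat * T | successor (sval t) mt.1 (sval mt.2)}.
  apply: cid; case: t => s [K g].
  have [m [s' [K' [h g']]]] := good_next g.
  by exists (m, exist _ s' (ex_intro _ K' g')).
pose t0 : T := exist _ s0 (ex_intro _ K0 g0).
pose F := fix F k : T := if k is k'.+1 then (sval (step (F k'))).2 else t0.
exists (fun k => sval (F k)), (fun k => (sval (step (F k))).1); split=> //.
  by move=> k; apply: (svalP (F k)).
by move=> k; apply: (svalP (step (F k))).
Qed.

End Hierarchy.

(** * The eigenvalue *)

(* The numbers u, v are the return lengths and X, -Y their displacements.  A step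
   multiplies c = u Y + v X by M, whereas G grows at least by the factor
   M (1 + 1/N) when M > 1, so that X, Y <= 2 c / G. *)
Section Contraction.
Variables (R : realType) (u v X Y D c : nat -> R) (M : nat -> nat) (T : nat -> bool).
Variable N : nat.
Hypotheses (N4 : (4 <= N)%N).
Hypotheses (u1 : forall k, 0 < u k) (v1 : forall k, 0 < v k) (D1 : forall k, 0 < D k).
Hypotheses (X0 : forall k, 0 <= X k) (Y0 : forall k, 0 <= Y k).
Hypothesis cE : forall k, u k * Y k + v k * X k = c k.
Hypothesis M0 : forall k, (0 < M k)%N.
Hypothesis stepT : forall k, T k ->
  [/\ u k.+1 = v k + (M k)%:R * u k, v k.+1 = v k,
      X k.+1 = (M k)%:R * X k - Y k, Y k.+1 = Y k &
      D k.+1 = D k + ((M k)%:R - 1) * u k].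
Hypothesis stepF : forall k, ~~ T k ->
  [/\ v k.+1 = u k + (M k)%:R * v k, u k.+1 = u k,
      Y k.+1 = (M k)%:R * Y k - X k, X k.+1 = X k &
      D k.+1 = D k + ((M k)%:R - 1) * v k].
Hypothesis strongT : forall k, T k -> (1 < M k)%N ->
  (M k)%:R * u k <= N%:R * (v k - ((M k)%:R - 2) * u k - 3 * D k).
Hypothesis strongF : forall k, ~~ T k -> (1 < M k)%N ->
  (M k)%:R * v k <= N%:R * (u k - ((M k)%:R - 2) * v k - 3 * D k).
Hypothesis u_unbounded : forall B, exists k, B <= u k.
Hypothesis v_unbounded : forall B, exists k, B <= v k.

Let E k := X k + Y k.
Let G k := Num.min (2 * Num.min (u k) (v k)) (3 * D k).
Let beta k := c k / G k.
Definition step_cost k := if T k then Y k else X k.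

Let N0 : (0 : R) < N%:R. Proof. by rewrite ltr0n (leq_trans _ N4). Qed.

Let N4R : (4 : R) <= N%:R. Proof. by rewrite ler_nat. Qed.

Let G0 k : 0 < G k.
Proof. by rewrite /G lt_min !mulr_gt0 ?lt_min ?u1 ?v1 ?D1. Qed.

Let G_le k : G k <= 2 * u k /\ G k <= 2 * v k.
Proof.
have h : G k <= 2 * Num.min (u k) (v k) by rewrite /G ge_min lexx.
have hu : Num.min (u k) (v k) <= u k by rewrite ge_min lexx.
have hv : Num.min (u k) (v k) <= v k by rewrite ge_min lexx orbT.
by split; apply: le_trans h _; rewrite ler_pM2l.
Qed.

Let G_ge z k : z <= 2 * u k -> z <= 2 * v k -> z <= 3 * D k -> z <= G k.
Proof.
move=> h1 h2 h3; rewrite /G le_min h3 andbT.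
by have [] := leP (u k) (v k).
Qed.

Let cS k : c k.+1 = (M k)%:R * c k.
Proof.
rewrite -!cE; case: (boolP (T k)) => [/stepT|/stepF] [-> -> -> -> _]; ring.
Qed.

Let c0 k : 0 <= c k.
Proof. by rewrite -cE addr_ge0 // mulr_ge0 // ltW. Qed.

Let M1 k : (1 : R) <= (M k)%:R. Proof. by rewrite ler1n. Qed.

Let mono k : [/\ u k <= u k.+1, v k <= v k.+1 & D k <= D k.+1].
Proof.
have := u1 k; have := v1 k; have := M1 k.
case: (boolP (T k)) => [/stepT|/stepF] [e1 e2 _ _ e3] h1 h2 h3; split;
  rewrite ?e1 ?e2 ?e3 //; nra.
Qed.

Let umono k l : (k <= l)%N -> u k <= u l.
Proof.
elim: l => [|l IH]; first by case: k.
by rewrite leq_eqVlt ltnS => /predU1P [->//|/IH /le_trans]; apply; case: (mono l).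
Qed.

Let vmono k l : (k <= l)%N -> v k <= v l.
Proof.
elim: l => [|l IH]; first by case: k.
by rewrite leq_eqVlt ltnS => /predU1P [->//|/IH /le_trans]; apply; case: (mono l).
Qed.

Let G_mono k : G k <= G k.+1.
Proof.
have [h1 h2 h3] := mono k; rewrite /G le_min ge_min ge_min.
by rewrite !ler_pM2l // le_min ge_min h1 ge_min h2 h3 !orbT.
Qed.

(* This is where the slack 1/N in the complexity bound enters. *)
Let G_strong k : (1 < M k)%N -> (M k)%:R * (1 + N%:R^-1) * G k <= G k.+1.
Proof.
move=> m2; have : (2 : R) <= (M k)%:R by rewrite ler_nat.
have := G0 k; have := u1 k; have := v1 k.
have : G k <= 3 * D k by rewrite /G ge_min lexx orbT.
have [] := G_le k.
have Ni : N%:R^-1 * N%:R = 1 :> R by rewrite mulVf // gt_eqF.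
have Ni0 : 0 < N%:R^-1 :> R by rewrite invr_gt0.
have Ni4 : N%:R^-1 * 4 <= 1 :> R by rewrite mulrC ler_pdivrMr ?mul1r.
have key (w z : R) : (2 : R) <= (M k)%:R ->
    (M k)%:R * z <= N%:R * (w - ((M k)%:R - 2) * z - 3 * D k) -> G k <= 3 * D k ->
    0 < G k -> G k <= 2 * z ->
    (M k)%:R * (1 + N%:R^-1) * G k <= 2 * w /\
    (M k)%:R * (1 + N%:R^-1) * G k <= 3 * (D k + ((M k)%:R - 1) * z).
  move: (M k)%:R (G k) (D k) => m g d hm hs hd hg hz.
  have {}hs : N%:R^-1 * (m * z) <= w - (m - 2) * z - 3 * d.
    by rewrite ler_pdivrMl.
  move: N%:R^-1 Ni0 Ni4 hs => r r0 r4 hs.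
  split.
    have h1 : r * (m * g) <= r * (m * (2 * z)).
      by rewrite ler_pM2l // ler_pM2l //; lra.
    have h2 : (m - 2) * g <= (m - 2) * (2 * z) by apply: ler_wpM2l; lra.
    lra.
  have h2 : (m - 1) * g <= (m - 1) * (2 * z) by apply: ler_wpM2l; lra.
  have h3 : 4 * (r * (m * g)) <= m * g.
    rewrite mulrA [4 * r]mulrC -[leRHS]mul1r; apply: ler_wpM2r => //.
    by apply: mulr_ge0; lra.
  have h4 : 2 * g <= m * g by apply: ler_wpM2r; lra.
  lra.
move=> hu hv hd v0 u0 g0 hm; have hM := M1 k.
case: (boolP (T k)) => [Tk|Tk].
  have [k1 k2] := key _ _ hm (strongT Tk m2) hd g0 hu.
  have [e1 e2 _ _ e3] := stepT Tk.
  apply: G_ge; rewrite ?e1 ?e2 ?e3 //.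
  by apply: le_trans k1 _; rewrite ler_pM2l //; nra.
have [k1 k2] := key _ _ hm (strongF Tk m2) hd g0 hv.
have [e1 e2 _ _ e3] := stepF Tk.
apply: G_ge; rewrite ?e1 ?e2 ?e3 //.
by apply: le_trans k1 _; rewrite ler_pM2l //; nra.
Qed.

Let rho : R := (1 + N%:R^-1)^-1.

Let Ni0 : (0 : R) < N%:R^-1. Proof. by rewrite invr_gt0. Qed.

Let rho0 : 0 < rho. Proof. by rewrite invr_gt0 addr_gt0. Qed.

Let rhoE : rho * N%:R^-1 = 1 - rho.
Proof.
have h : rho * (1 + N%:R^-1) = 1 by rewrite mulVf // gt_eqF // addr_gt0.
by move: h; rewrite mulrDr mulr1; lra.
Qed.

Let beta0 k : 0 <= beta k. Proof. by rewrite divr_ge0 // ltW. Qed.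

Let beta_weak k : M k = 1%N -> beta k.+1 <= beta k.
Proof.
move=> m1; rewrite /beta cS m1 mul1r; apply: ler_wpM2l => //.
by rewrite lef_pV2 ?posrE // G_mono.
Qed.

Let beta_strong k : (1 < M k)%N -> beta k.+1 <= rho * beta k.
Proof.
move=> m1; rewrite /beta cS ler_pdivrMr // [leRHS]mulrAC.
have h := G_strong m1.
have -> : (M k)%:R * c k = rho * (c k / G k) * ((M k)%:R * (1 + N%:R^-1) * G k).
  rewrite /rho; field; rewrite !gt_eqF ?addr_gt0 //=.
rewrite [leRHS]mulrAC; apply: ler_wpM2l => //.
exact: mulr_ge0 (ltW rho0) (beta0 k).
Qed.

Let rho1 : rho < 1. Proof. by have := mulr_gt0 rho0 Ni0; rewrite rhoE; lra. Qed.

Let beta_noninc k : beta k.+1 <= beta k.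
Proof.
have [m1|m1] := leqP (M k) 1; first by apply: beta_weak; have := M0 k; case: (M k) m1 => [|[]].
by apply: le_trans (beta_strong m1) _; rewrite ler_piMl // ltW.
Qed.

Let beta_le k l : (k <= l)%N -> beta l <= beta k.
Proof.
elim: l => [|l IH]; first by case: k.
by rewrite leq_eqVlt ltnS => /predU1P [->//|/IH]; apply: le_trans.
Qed.

Let E_beta k : E k <= 4 * beta k.
Proof.
rewrite /beta mulrA ler_pdivlMr // /E mulrDl.
have [h1 h2] := G_le k.
have h3 : X k * G k <= X k * (2 * v k) by apply: ler_wpM2l.
have h4 : Y k * G k <= Y k * (2 * u k) by apply: ler_wpM2l.
have h5 : 0 <= u k * Y k by rewrite mulr_ge0 // ltW.
have h6 : 0 <= v k * X k by rewrite mulr_ge0 // ltW.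
by have := cE k; lra.
Qed.

Let E0 k : 0 <= E k. Proof. exact: addr_ge0. Qed.

Let cost_weak k : M k = 1%N -> step_cost k = E k - E k.+1.
Proof.
rewrite /step_cost /E => m1.
by case: (boolP (T k)) => [/stepT|/stepF] [_ _ -> -> _]; rewrite m1; ring.
Qed.

Let cost_strong k : step_cost k <= E k - E k.+1 + E k.+1.
Proof.
by rewrite subrK /step_cost /E; case: ifP => _; rewrite ?lerDl ?lerDr.
Qed.

(* A potential that pays for the costs of all later steps. *)
Let Omega k := E k + 4 * N%:R * beta k.

Let cost_Omega k : step_cost k <= Omega k - Omega k.+1.
Proof.
have NN : 0 <= 4 * N%:R :> R by rewrite mulr_ge0 // ltW.
have [m1|m1] := leqP (M k) 1.
  have e : M k = 1%N by have := M0 k; case: (M k) m1 => [|[]].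
  have := ler_wpM2l NN (beta_noninc k); rewrite /Omega (cost_weak e); lra.
apply: le_trans (cost_strong k) _.
have h1 := E_beta k.+1; have h2 := beta_strong m1.
have h3 : 4 * N%:R * (1 - rho) * beta k = 4 * (rho * beta k).
  by rewrite -rhoE; field; rewrite gt_eqF.
have h4 := ler_wpM2l NN h2.
rewrite /Omega; lra.
Qed.

Let cost_sum_Omega k n : \sum_(k <= l < k + n) step_cost l <= Omega k.
Proof.
suff h : \sum_(k <= l < k + n) step_cost l <= Omega k - Omega (k + n).
  apply: le_trans h _; rewrite gerBl; apply: addr_ge0 => //.
  exact: mulr_ge0 (mulr_ge0 _ (ltW N0)) (beta0 _).
elim: n => [|n IH]; first by rewrite addn0 big_geq // subrr.
rewrite addnS big_nat_recr ?leq_addr //=.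
by have := cost_Omega (k + n); lra.
Qed.

Let archi (e B : R) : 0 < e -> exists n : nat, B <= n%:R * e.
Proof.
move=> e0; exists (Num.truncn `|B / e|).+1; rewrite -ler_pdivrMr //.
apply: le_trans (ler_norm _) _; apply/ltW; exact: Num.Theory.truncnS_gt.
Qed.

Let strong_case (e : R) : (forall k, exists2 l, (k <= l)%N & (1 < M l)%N) -> 0 < e ->
  exists k, beta k <= e.
Proof.
move=> inf e0.
have h n : exists k, beta k <= rho ^+ n * beta 0.
  elim: n => [|n [k IH]]; first by exists 0%N; rewrite expr0 mul1r.
  have [l kl ml] := inf k; exists l.+1; apply: le_trans (beta_strong ml) _.
  rewrite exprS -mulrA ler_pM2l //; apply: le_trans IH; exact: beta_le.
have [n hn] := archi (beta 0) (mulr_gt0 e0 Ni0).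
have [k hk] := h n; exists k; apply: le_trans hk _.
have hB : 1 + n%:R * N%:R^-1 <= (1 + N%:R^-1) ^+ n :> R.
  elim: (n) => [|m IH]; first by rewrite mul0r addr0 expr0.
  have h0 : 0 <= 1 + N%:R^-1 :> R by rewrite addr_ge0 // ltW.
  rewrite exprS; apply: le_trans (ler_wpM2l h0 IH).
  have : 0 <= m%:R * N%:R^-1 * N%:R^-1 :> R.
    by rewrite mulr_ge0 ?(ltW Ni0) // mulr_ge0 // ltW.
  by rewrite -natr1; lra.
have p0 : 0 < (1 + N%:R^-1) ^+ n :> R by rewrite exprn_gt0 // addr_gt0.
rewrite /rho exprVn mulrC ler_pdivrMr //.
apply: le_trans hn _; rewrite mulrCA; apply: ler_wpM2l; first exact: ltW.
by apply: le_trans hB; rewrite lerDr.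
Qed.

Theorem contraction (e : R) : 0 < e -> exists k,
  (forall n, \sum_(k <= l < k + n) step_cost l <= e) /\
  (forall l, (k <= l)%N -> X l + Y l <= e).
Proof.
move=> e0.
have [inf|] := pselect (forall k, exists2 l, (k <= l)%N & (1 < M l)%N).
  have f0 : 0 < 4 + 4 * N%:R :> R by rewrite addr_gt0 // mulr_gt0.
  have [k hk] := strong_case inf (divr_gt0 e0 f0); exists k.
  have {}hk : 4 * beta k + 4 * N%:R * beta k <= e.
    by rewrite -mulrDl mulrC -ler_pdivlMr.
  have Nb : 0 <= 4 * N%:R * beta k := mulr_ge0 (mulr_ge0 (ler0n _ _) (ltW N0)) (beta0 k).
  split=> [n|l kl].
    apply: le_trans (cost_sum_Omega k n) _; rewrite /Omega.
    by have := E_beta k; lra.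
  by have := E_beta l; have := beta_le kl; rewrite /E; lra.
move=> /existsNP [k0 hk0].
have w l : (k0 <= l)%N -> M l = 1%N.
  move=> kl; have [m1|m1] := leqP (M l) 1; last by case: hk0; exists l.
  by have := M0 l; case: (M l) m1 => [|[]].
have cc l : (k0 <= l)%N -> c l = c k0.
  elim: l => [|l IH]; first by case: k0 {hk0 w}.
  rewrite leq_eqVlt ltnS => /predU1P [<-//|kl].
  by rewrite cS w // mul1r IH.
have [k1 h1] := u_unbounded (2 * c k0 / e + 1).
have [k2 h2] := v_unbounded (2 * c k0 / e + 1).
pose k := maxn k0 (maxn k1 k2).
have small l : (k <= l)%N -> X l + Y l <= e.
  rewrite !geq_max => /and3P [l0 l1 l2].
  have hu : 2 * c k0 / e <= u l by have := umono l1; lra.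
  have hv : 2 * c k0 / e <= v l by have := vmono l2; lra.
  rewrite ler_pdivrMr // in hu; rewrite ler_pdivrMr // in hv.
  have := cE l; rewrite cc // => hc.
  have y0 : 0 <= u l * Y l by rewrite mulr_ge0 // ltW.
  have x0 : 0 <= v l * X l by rewrite mulr_ge0 // ltW.
  have hx : X l <= e / 2.
    by rewrite -(ler_pM2l (v1 l)); lra.
  have hy : Y l <= e / 2.
    by rewrite -(ler_pM2l (u1 l)); lra.
  lra.
exists k; split=> // n.
have hE : \sum_(k <= l < k + n) step_cost l = E k - E (k + n).
  elim: n => [|n IH]; first by rewrite addn0 big_geq // subrr.
  rewrite addnS big_nat_recr ?leq_addr //= IH cost_weak; first by lra.
  by apply: w; apply: leq_trans (leq_addr _ _); rewrite leq_maxl.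
by rewrite hE; have := E0 (k + n); have := small k (leqnn k); rewrite /E; lra.
Qed.

End Contraction.

Section Counter.

Lemma counter_exists (P : int -> bool) :
  exists c : int -> int, forall i, c (i + 1) = c i + (P i)%:Z.
Proof.
exists (fun i => match i with
  | Posz n => (\sum_(0 <= t < n) P t%:Z)%N%:Z
  | Negz n => - (\sum_(0 <= t < n.+1) P (- t.+1%:Z))%N%:Z end).
case=> [n|n].
  have -> : n%:Z + 1 = n.+1%:Z by lia.
  by rewrite big_nat_recr //= PoszD.
case: n => [|n].
  have -> : Negz 0 + 1 = 0%:Z by lia.
  by rewrite big_geq // big_nat1 NegzE addNr.
have -> : Negz n.+1 + 1 = Negz n by lia.
rewrite [in RHS]big_nat_recr //= PoszD opprD NegzE -addrA addNr addr0 //.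
Qed.

Variables (P : int -> bool) (c : int -> int).
Hypothesis cS : forall i, c (i + 1) = c i + (P i)%:Z.

Lemma counter_add i (n : nat) : (forall t, i <= t -> t < i + n%:Z -> ~~ P t) ->
  c (i + n%:Z) = c i.
Proof.
elim: n => [|n IH] h; first by rewrite addr0.
have -> : i + n.+1%:Z = i + n%:Z + 1 by lia.
rewrite cS IH; last by move=> t t0 t1; apply: h; lia.
by rewrite (negPf (h (i + n%:Z) _ _)); lia.
Qed.

Lemma counter_const i j : i <= j -> (forall t, i <= t -> t < j -> ~~ P t) -> c j = c i.
Proof.
move=> ij h; have e : j = i + (absz (j - i)%R)%:Z by lia.
by rewrite e; apply: counter_add => t t0 t1; apply: h; lia.
Qed.

Lemma counter_next i j : i < j -> P i -> (forall t, i < t -> t < j -> ~~ P t) ->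
  c j = c i + 1.
Proof.
move=> ij Pi h; have {1}-> : j = i + 1 + (absz (j - i - 1)%R)%:Z by lia.
rewrite counter_add; first by rewrite cS Pi.
by move=> t t0 t1; apply: h; lia.
Qed.

Lemma counter_le_gen (P' : int -> bool) (c' : int -> int) i j :
  (forall i, c' (i + 1) = c' i + (P' i)%:Z) -> (forall i, P' i -> P i) -> i <= j ->
  0 <= c' j - c' i /\ c' j - c' i <= c j - c i.
Proof.
move=> cS' sub ij; have -> : j = i + (absz (j - i)%R)%:Z by lia.
elim: (absz (j - i)%R) => [|n IH]; first by rewrite addr0; lia.
have -> : i + n.+1%:Z = i + n%:Z + 1 by lia.
rewrite cS cS'; have := sub (i + n%:Z).
case: (P' _) (P _) => [] [] h; [lia| |lia|lia].
by have := h isT.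
Qed.

Lemma counter_mono i j : i <= j -> 0 <= c j - c i.
Proof. by move=> /(counter_le_gen cS (fun i h => h)) []. Qed.

End Counter.

Section Heights.
Variables (A : finType) (x : int -> A).
Hypotheses (Hrec : recurrent x) (Hap : not_right_periodic x).
Variable R : realType.

Definition occ_bool s i := `[< occ x s i >].

(* H i = gamma i - psi i for an integer valued psi, so that small oscillations of H
   on the occurrences of long words make gamma (i - j) close to an integer. *)
Section Climb.
Variables (s s' : state) (m : nat).
Hypotheses (w : wf x s) (st : astep x s m s').
Variables (H : int -> R) (X Y : R).
Hypotheses (X0 : 0 <= X) (Y0 : 0 <= Y).
Hypothesis HX : forall i, occa x s i -> H (i + su s) = H i + X.
Hypothesis HY : forall i, occb x s i -> H (i + sv s) = H i - Y.

Lemma run_height r i : run x s i r -> H (i + r%:Z * su s) = H i + r%:R * X.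
Proof.
elim: r i => [|r IH] i; first by rewrite !mul0r !addr0.
move=> /runS [h1 h2].
have -> : i + r.+1%:Z * su s = i + su s + r%:Z * su s by lia.
by rewrite IH // HX // -natr1; ring.
Qed.

Lemma climb_next i : occ x s i -> exists n,
  [/\ occ x s' n, i <= n, H i <= H n & forall j, i <= j -> j < n -> ~ occ x s' j].
Proof.
move=> ho; have [r hr] := run_exists Hap w ho; have u0 := wf_u w.
exists (i + r%:Z * su s); split.
- by apply/(occ_step w st); case: hr.
- nia.
- by rewrite run_height // lerDl mulr_ge0.
- move=> j j0 j1 /(occ_step w st) hb.
  have [ha _] := run_gap w hr j0 j1 (occb_occ w hb).
  exact: occa_occb w ha hb.
Qed.

Lemma climb_prev i : occ x s i -> exists p,
  [/\ occ x s' p, p <= i, H p - Y <= H i,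
      p < i -> ~ occ x s' i & forall j, p < j -> j < i -> ~ occ x s' j].
Proof.
move=> ho; case: (wf_occ w ho) => [ha|hb]; last first.
  exists i; split=> //; first exact/(occ_step w st).
  - by rewrite gerBl.
  - by rewrite ltxx.
  - by move=> j; lia.
have [L HL] := Hrec (sb s) (sq s + 1).
have [i0 [h1 h2 h3]] := HL (i - L).
have [||p [pi hn hno]] := @last_before (occb x s) i0 i; [lia | exact: h3 |].
have hni : ~ occb x s i by exact: occa_occb w ha.
exists p; split.
- exact/(occ_step w st).
- exact: ltW.
- have v0 := wf_v w; have u0 := wf_u w.
  have pv : p + sv s <= i.
    by rewrite leNgt; apply/negP => c; apply: (gapb w hn _ c ho); lia.
  have nob k : occb x s k -> p < k -> k <= i -> False.
    move=> hk k1; rewrite le_eqVlt => /predU1P [e|c]; first by rewrite e in hk.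
    exact: hno hk.
  case: (as_run st hn) => hr.
    by case: (nob (p + sv s)); [exact/run0 | lia | lia].
  have [_ hr2] := hr.
  have c : i < p + sv s + m%:Z * su s.
    rewrite ltNge; apply/negP => c; apply: (nob _ hr2) => //.
    nia.
  have [_ [t [tm et]]] := run_gap w hr pv c ho.
  have : H i = H (p + sv s) + t%:R * X.
    rewrite et; elim: (t) tm => [|k IH] km; first by rewrite !mul0r !addr0.
    have -> : p + sv s + k.+1%:Z * su s = p + sv s + k%:Z * su s + su s by lia.
    rewrite HX; last by case: hr => h _; apply: h; lia.
    by rewrite IH; [rewrite -natr1; ring | lia].
  by move=> ->; rewrite HY // lerDl mulr_ge0.
- by move=> _ /(occ_step w st).
- by move=> j j0 j1 /(occ_step w st); apply: hno.
Qed.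

(* The function cnt counts occurrences: |cnt i - cnt j| is their number between i
   and j. *)
Definition osc s (cnt : int -> int) (F : int -> R) (d : int) (B : R) :=
  forall i j, occ x s i -> occ x s j -> `|cnt i - cnt j| <= d -> F i - F j <= B.

Variables cnt cnt' : int -> int.
Hypothesis cntS : forall i, cnt (i + 1) = cnt i + (occ_bool s i)%:Z.
Hypothesis cntS' : forall i, cnt' (i + 1) = cnt' i + (occ_bool s' i)%:Z.

Lemma osc_step d B : 1 <= d -> osc s' cnt' H d B -> osc s cnt H d (B + Y).
Proof.
move=> d1 hB i j hi hj hd.
have [n [n1 n2 n3 n4]] := climb_next hi.
have [p [p1 p2 p3 p4 p5]] := climb_prev hj.
suff hnp : `|cnt' n - cnt' p| <= d.
  by have := hB _ _ n1 p1 hnp; lra.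
have en : cnt' n = cnt' i.
  by apply: (counter_const cntS') => // t t0 t1; apply/asboolPn; exact: n4.
have sub k : occ_bool s' k -> occ_bool s k.
  by move=> /asboolP /(occ_step w st) /(occb_occ w) h; apply/asboolP.
have le k l : k <= l -> 0 <= cnt' l - cnt' k /\ cnt' l - cnt' k <= cnt l - cnt k.
  exact: counter_le_gen.
have [pj|pj] : p < j \/ p = j by lia.
  have ep : cnt' j = cnt' p + 1.
    apply: (counter_next cntS') => //; first exact/asboolP.
    by move=> t t0 t1; apply/asboolPn; exact: p5.
  have ej : cnt' (j + 1) = cnt' j.
    by rewrite cntS' /occ_bool (asboolF (p4 pj)) addr0.
  have ej' : cnt (j + 1) = cnt j + 1.
    by rewrite cntS /occ_bool (asboolT hj).
  case: (ltgtP i j) => c.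
  - by have := le _ _ (ltW c); lia.
  - by have := le (j + 1) i; lia.
  - by rewrite en c; lia.
rewrite en pj; case: (leP i j) => c.
  by have := le _ _ c; lia.
by have := le _ _ (ltW c); lia.
Qed.

Lemma osc_base d : 0 <= d -> osc s cnt H d (d%:~R * (X + Y)).
Proof.
move=> d0.
have E0 : 0 <= X + Y by rewrite addr_ge0.
have main (k : nat) : forall i j, occ x s i -> occ x s j -> i <= j ->
    cnt j - cnt i = k%:Z -> `|H i - H j| <= k%:R * (X + Y).
  elim: k => [|k IH] i j hi hj ij hc.
    move: ij; rewrite le_eqVlt => /predU1P [->|c].
      by rewrite subrr normr0 mul0r.
    have := counter_mono cntS (i := i + 1) (j := j).
    by rewrite cntS /occ_bool (asboolT hi); lia.
  have ne : i < j by case: (ltgtP i j) ij hc => // ->; lia.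
  have [l [l0 hl hg hH]] : exists l, [/\ 0 < l, occ x s (i + l),
      forall t, i < t -> t < i + l -> ~ occ x s t & `|H i - H (i + l)| <= X + Y].
    case: (wf_occ w hi) => ho.
      exists (su s); split; [exact: wf_u w | exact: nexta | by move=> t; apply: gapa |].
      by rewrite HX // opprD addrA subrr add0r normrN ger0_norm // lerDl.
    exists (sv s); split; [exact: wf_v w | exact: nextb | by move=> t; apply: gapb |].
    by rewrite HY // opprB addrC subrK ger0_norm // lerDr.
  have lj : i + l <= j.
    by rewrite leNgt; apply/negP => c; apply: (hg j).
  have cl : cnt (i + l) = cnt i + 1.
    apply: (counter_next cntS) => //; [lia | exact/asboolP |].
    by move=> t t0 t1; apply/asboolPn; apply: hg.
  have := IH (i + l) j hl hj lj; rewrite cl => h.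
  have {}h : `|H (i + l) - H j| <= k%:R * (X + Y) by apply: h; lia.
  have -> : H i - H j = (H i - H (i + l)) + (H (i + l) - H j) by ring.
  apply: le_trans (ler_normD _ _) _; rewrite -natr1 mulrDl mul1r addrC.
  exact: lerD.
move=> i j hi hj hd.
have hk k (y z : R) : 0 <= k -> k <= d -> `|y| <= (absz k)%:R * (X + Y) ->
    y <= d%:~R * (X + Y).
  move=> k0 kd h; apply: le_trans (ler_norm _) _; apply: (le_trans h).
  apply: ler_wpM2r => //; have -> : d = (absz d)%:Z by lia.
  by rewrite -pmulrn ler_nat; lia.
case: (leP i j) => c.
  have c0 := counter_mono cntS c.
  by apply: (hk (cnt j - cnt i)) => //; [lia | apply: main => //; lia].
have c0 := counter_mono cntS (ltW c).
apply: (hk (cnt i - cnt j)) => //; first lia.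
by rewrite distrC; apply: main => //; [exact: ltW | lia].
Qed.

End Climb.

Section Cochain.
Variables (s s' : state) (m : nat) (psi : int -> int).
Hypotheses (w : wf x s) (st : astep x s m s').

Definition cochain s a b :=
  (forall i, occa x s i -> psi (i + su s) = psi i + a) /\
  (forall i, occb x s i -> psi (i + sv s) = psi i + b).

Lemma cochain_swap a b : cochain s a b -> cochain (swap s) b a.
Proof. by case. Qed.

Lemma cochain_step a b : cochain s a b -> cochain s' (b + m%:Z * a) b.
Proof.
move=> [ca cb].
have cr r i : run x s i r -> psi (i + r%:Z * su s) = psi i + r%:Z * a.
  elim: r i => [|r IH] i; first by rewrite !mul0r !addr0.
  move=> /runS [h1 h2].
  have -> : i + r.+1%:Z * su s = i + su s + r%:Z * su s by lia.
  by rewrite IH // ca //; lia.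
split=> i.
  move=> /(occa_step w st) [h1 h2].
  by rewrite (as_u st) addrA cr // cb //; lia.
by move=> /(occb_step w st) [h1 _]; rewrite (as_v st) cb.
Qed.

End Cochain.

Lemma cochain_exists s : wf x s -> exists psi, cochain psi s 0 1.
Proof.
move=> w; have [psi hpsi] := counter_exists (fun i => `[< occb x s i >]).
exists psi; have u0 := wf_u w; have v0 := wf_v w; split=> i hi.
  rewrite addr0; apply: (counter_const hpsi); first lia.
  move=> t t0 t1; apply/asboolPn => hb; have [e|ne] := eqVneq i t.
    by rewrite -e in hb; apply: occa_occb w hi hb.
  by apply: (gapa w hi _ t1 (occb_occ w hb)); lia.
apply: (counter_next hpsi); first lia.
  exact/asboolP.
by move=> t t0 t1; apply/asboolPn => hb; apply: (gapb w hi t0 t1 (occb_occ w hb)).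
Qed.

(* Otherwise the powers of a fixed return occur in x. *)
Lemma only_asteps_absurd (S : nat -> state) (M : nat -> nat) :
  (forall k, wf x (S k)) -> (forall k, astep x (S k) (M k) (S k.+1)) -> False.
Proof.
move=> w st; pose v := sv (S 0%N).
have ev k : sv (S k) = v by elim: k => // k IH; rewrite (as_v (st k)).
have v0 : 0 < v by exact: wf_v (w 0%N).
have pow l : forall j, occ x (S l) j ->
    forall t : nat, (t < l)%N -> occb x (S 0%N) (j + t%:Z * v).
  elim: l => [|l IH] j //.
  move=> /(occ_step (w l) (st l)) hb t tl.
  case: l IH hb tl => [|l] IH hb tl.
    by have -> : t = 0%N by [case: t tl]; rewrite mul0r addr0.
  case: t tl => [|t] tl; first by apply: IH => //; exact: occb_occ (w _) hb.
  have -> : j + t.+1%:Z * v = j + v + t%:Z * v by lia.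
  by apply: IH => //; rewrite -(ev l.+1); apply: nextb (w _) hb.
have [L HL] := Hrec (sa (S 0%N)) (sq (S 0%N) + 1).
pose l := absz L; pose j := sa (S l).
have [i [h1 h2 h3]] := HL j.
have ha : occa x (S 0%N) i by [].
have far (t : nat) : (t <= l)%N -> j + t%:Z * v <= i.
  elim: t => [|t IH] tl; first lia.
  have hb : occb x (S 0%N) (j + t%:Z * v) by apply: pow => //; apply: agree_refl.
  have le := IH (ltnW tl).
  rewrite leNgt; apply/negP => c.
  move: le; rewrite le_eqVlt => /predU1P [e|lt].
    by rewrite e in hb; apply: occa_occb (w _) ha hb.
  by apply: (gapb (w 0%N) hb lt _ (occa_occ ha)); rewrite -/v; lia.
have := far l (leqnn l); nia.
Qed.

End Heights.

Section Frequency.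
Variables (A : finType) (x : int -> A).
Hypotheses (Hrec : recurrent x) (Hap : not_right_periodic x).
Variable R : realType.
Variables (N : nat) (S : nat -> state) (M : nat -> nat).
Hypothesis N4 : (4 <= N)%N.
Hypothesis Sw : forall k, wf x (S k).
Hypothesis Sn : forall k, successor x N (S k) (M k) (S k.+1).

Let T k := `[< link x N (S k) (M k) (S k.+1) >].

Let ST k : T k -> link x N (S k) (M k) (S k.+1).
Proof. by move/asboolP. Qed.

Let SF k : ~~ T k -> link x N (swap (S k)) (M k) (swap (S k.+1)).
Proof. by move/asboolPn => h; case: (Sn k). Qed.

(* The integers by which psi increases along the two returns; the angle lies between
   a_k / u_k and b_k / v_k for all k. *)
Fixpoint coef k : int * int :=
  if k is k'.+1 then
    let: (a, b) := coef k' in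
    if T k' then (b + (M k')%:Z * a, b) else (a, a + (M k')%:Z * b)
  else (0, 1).

Let a k := (coef k).1.
Let b k := (coef k).2.

Let coefT k : T k -> a k.+1 = b k + (M k)%:Z * a k /\ b k.+1 = b k.
Proof. by rewrite /a /b /=; case: (coef k) => a' b' /= ->. Qed.

Let coefF k : ~~ T k -> b k.+1 = a k + (M k)%:Z * b k /\ a k.+1 = a k.
Proof. by rewrite /a /b /=; case: (coef k) => a' b' /= /negPf ->. Qed.

Let u k : int := su (S k).
Let v k : int := sv (S k).

Let uvT k : T k -> [/\ u k.+1 = v k + (M k)%:Z * u k, v k.+1 = v k &
  excess (S k.+1) = excess (S k) + ((M k)%:Z - 1) * u k].
Proof.
move=> /ST [st _]; rewrite /u /v (as_u st) (as_v st); split=> //.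
by rewrite /excess (as_u st) (as_v st) (as_q st); lia.
Qed.

Let uvF k : ~~ T k -> [/\ v k.+1 = u k + (M k)%:Z * v k, u k.+1 = u k &
  excess (S k.+1) = excess (S k) + ((M k)%:Z - 1) * v k].
Proof.
move=> /SF [st _]; have := as_u st; have := as_v st; have := as_q st.
by rewrite /excess /u /v /= => -> -> ->; split=> //; lia.
Qed.

Let M0 k : (0 < M k)%N.
Proof. by case: (boolP (T k)) => [/ST|/SF] [st _]; exact: as_m st. Qed.

Let u0 k : 0 < u k. Proof. exact: wf_u (Sw k). Qed.
Let v0 k : 0 < v k. Proof. exact: wf_v (Sw k). Qed.

Let det k := u k * b k - v k * a k.

Let det0 k : 0 < det k.
Proof.
elim: k => [|k IH]; first by rewrite /det /a /b /=; have := u0 0%N; lia.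
have -> : det k.+1 = (M k)%:Z * det k.
  rewrite /det; case: (boolP (T k)) => Tk.
    by have [-> -> _] := uvT Tk; have [-> ->] := coefT Tk; ring.
  by have [-> -> _] := uvF Tk; have [-> ->] := coefF Tk; ring.
by rewrite mulr_gt0 // ltz_nat.
Qed.

Let U k : R := (u k)%:~R.
Let V k : R := (v k)%:~R.
Let Ar k : R := (a k)%:~R.
Let Br k : R := (b k)%:~R.

Let U0 k : 0 < U k. Proof. by rewrite ltr0z. Qed.
Let V0 k : 0 < V k. Proof. by rewrite ltr0z. Qed.

Let detR k : V k * Ar k < U k * Br k.
Proof. by rewrite -!intrM ltr_int; have := det0 k; rewrite /det; lia. Qed.

Let stepTR k : T k -> [/\ U k.+1 = V k + (M k)%:R * U k, V k.+1 = V k,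
  Ar k.+1 = Br k + (M k)%:R * Ar k & Br k.+1 = Br k].
Proof.
move=> Tk; have [h1 h2 _] := uvT Tk; have [h3 h4] := coefT Tk.
by rewrite /U /V /Ar /Br h1 h2 h3 h4 !rmorphD !rmorphM.
Qed.

Let stepFR k : ~~ T k -> [/\ V k.+1 = U k + (M k)%:R * V k, U k.+1 = U k,
  Br k.+1 = Ar k + (M k)%:R * Br k & Ar k.+1 = Ar k].
Proof.
move=> Tk; have [h1 h2 _] := uvF Tk; have [h3 h4] := coefF Tk.
by rewrite /U /V /Ar /Br h1 h2 h3 h4 !rmorphD !rmorphM.
Qed.

Let nested k : Ar k / U k <= Ar k.+1 / U k.+1 /\ Br k.+1 / V k.+1 <= Br k / V k.
Proof.
have := detR k; have MR : 0 < (M k)%:R :> R by rewrite ltr0n.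
case: (boolP (T k)) => Tk h.
  have [e1 e2 e3 e4] := stepTR Tk; rewrite e1 e2 e3 e4; split=> //.
  rewrite ler_pdivrMr // mulrAC ler_pdivlMr ?addr_gt0 // ?mulr_gt0 //; lra.
have [e1 e2 e3 e4] := stepFR Tk; rewrite e1 e2 e3 e4; split=> //.
rewrite ler_pdivrMr; last by rewrite addr_gt0 // mulr_gt0.
rewrite mulrAC ler_pdivlMr //; lra.
Qed.

Let nest_le k l : Ar k / U k <= Br l / V l.
Proof.
have mA i j : (i <= j)%N -> Ar i / U i <= Ar j / U j.
  elim: j => [|j IH]; first by case: i.
  by rewrite leq_eqVlt ltnS => /predU1P [->//|/IH /le_trans]; apply; case: (nested j).
have mB i j : (i <= j)%N -> Br j / V j <= Br i / V i.
  elim: j => [|j IH]; first by case: i.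
  rewrite leq_eqVlt ltnS => /predU1P [->//|/IH]; apply: le_trans.
  by case: (nested j).
apply: le_trans (mA _ _ (leq_maxl k l)) _; apply: le_trans (mB _ _ (leq_maxr k l)).
by rewrite ler_pdivrMr // mulrAC ler_pdivlMr // ltW // mulrC [ltRHS]mulrC.
Qed.

Let P : set R := [set z | exists k, z = Ar k / U k]%classic.
Definition angle : R := sup P.

Let X k := angle * U k - Ar k.
Let Y k := Br k - angle * V k.

Let X0 k : 0 <= X k.
Proof.
rewrite subr_ge0 -ler_pdivrMr //; apply: ub_le_sup; last by exists k.
by exists (Br 0%N / V 0%N) => z [l ->]; apply: nest_le.
Qed.

Let Y0 k : 0 <= Y k.
Proof.
rewrite subr_ge0 -ler_pdivlMr //; apply: ge_sup; first by exists (Ar 0%N / U 0%N), 0%N.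
by move=> z [l ->]; apply: nest_le.
Qed.

Let XYT k : T k -> X k.+1 = (M k)%:R * X k - Y k /\ Y k.+1 = Y k.
Proof.
by move=> /stepTR [h1 h2 h3 h4]; rewrite /X /Y h1 h2 h3 h4; split=> //; ring.
Qed.

Let XYF k : ~~ T k -> Y k.+1 = (M k)%:R * Y k - X k /\ X k.+1 = X k.
Proof.
by move=> /stepFR [h1 h2 h3 h4]; rewrite /X /Y h1 h2 h3 h4; split=> //; ring.
Qed.

Let T_often k : exists2 l, (k <= l)%N & T l.
Proof.
apply: contrapT => hno.
apply: (@only_asteps_absurd _ x Hrec (fun l => swap (S (k + l)%N)) (fun l => M (k + l)%N)).
  by move=> l; apply: wf_swap.
move=> l; rewrite addnS; have Tk : ~~ T (k + l).
  by apply/negP => h; apply: hno; exists (k + l)%N => //; apply: leq_addr.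
by case: (SF Tk).
Qed.

Let F_often k : exists2 l, (k <= l)%N & ~~ T l.
Proof.
apply: contrapT => hno.
apply: (@only_asteps_absurd _ x Hrec (fun l => S (k + l)%N) (fun l => M (k + l)%N)) => //.
move=> l; rewrite addnS; have Tk : T (k + l).
  apply: contrapT => h; apply: hno; exists (k + l)%N; first exact: leq_addr.
  exact/negP.
by case: (ST Tk).
Qed.

Let unbounded (f : nat -> int) (Q : nat -> Prop) : (forall k, f k <= f k.+1) ->
  (forall k, Q k -> f k + 1 <= f k.+1) -> (forall k, 0 < f k) ->
  (forall k, exists2 l, (k <= l)%N & Q l) -> forall B : R, exists k, B <= (f k)%:~R.
Proof.
move=> f1 f2 f3 f4.
have mono k l : (k <= l)%N -> f k <= f l.
  elim: l => [|l IH]; first by case: k.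
  by rewrite leq_eqVlt ltnS => /predU1P [->//|/IH /le_trans]; apply.
have big (n : nat) : exists k, n%:Z <= f k.
  elim: n => [|n [k IH]]; first by exists 0%N; exact: ltW.
  have [l kl Ql] := f4 k; exists l.+1; have := f2 _ Ql; have := mono _ _ kl; lia.
move=> B; have [k hk] := big (Num.truncn `|B|).+1; exists k.
apply: le_trans (ler_norm _) _; apply/ltW/(lt_le_trans (truncnS_gt _)).
by rewrite pmulrn ler_int.
Qed.

Let u_unb B : exists k, B <= U k.
Proof.
apply: (@unbounded u T _ _ u0 T_often).
  move=> k; case: (boolP (T k)) => [/uvT|/uvF] [e1 e2 _].
    by have := u0 k; have := v0 k; have := M0 k; nia.
  by rewrite e2.
by move=> k /uvT [-> _ _]; have := u0 k; have := v0 k; have := M0 k; nia.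
Qed.

Let v_unb B : exists k, B <= V k.
Proof.
apply: (@unbounded v (fun k => ~~ T k) _ _ v0 F_often).
  move=> k; case: (boolP (T k)) => [/uvT|/uvF] [e1 e2 _].
    by rewrite e2.
  by have := u0 k; have := v0 k; have := M0 k; nia.
by move=> k /uvF [-> _ _]; have := u0 k; have := v0 k; have := M0 k; nia.
Qed.

Let cost := step_cost X Y T.

Let contr (e : R) : 0 < e -> exists k,
  (forall n, \sum_(k <= l < k + n) cost l <= e) /\
  (forall l, (k <= l)%N -> X l + Y l <= e).
Proof.
apply: (@contraction R U V X Y (fun k => (excess (S k))%:~R) (fun k => U k * Y k + V k * X k)
  M T N N4) => //.
- by move=> k; rewrite ltr0z; have := wf_excess (Sw k); rewrite /excess; lia.
- move=> k Tk; have [h1 h2 h3] := uvT Tk; have [h4 h5] := XYT Tk.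
  have [h6 h7 _ _] := stepTR Tk; split=> //.
  by rewrite h3 !(rmorphD, rmorphM, rmorphB, rmorph1) /= -?pmulrn.
- move=> k Tk; have [h1 h2 h3] := uvF Tk; have [h4 h5] := XYF Tk.
  have [h6 h7 _ _] := stepFR Tk; split=> //.
  by rewrite h3 !(rmorphD, rmorphM, rmorphB, rmorph1) /= -?pmulrn.
- move=> k /ST [_ sb] m1; have := sb m1; rewrite /strong_bound -(ler_int R).
  by rewrite !(rmorphM, rmorphB, rmorph_nat) /= -?pmulrn.
- move=> k /SF [_ sb] m1; have := sb m1; rewrite /strong_bound -(ler_int R).
  have -> : excess (swap (S k)) = excess (S k) by rewrite /excess /=; lia.
  by rewrite !(rmorphM, rmorphB, rmorph_nat) /= -?pmulrn.
Qed.

Lemma angle_irrational (n z : int) : 0 < n -> n%:~R * angle <> z%:~R.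
Proof.
move=> n0 e; have nR : 0 < n%:~R :> R by rewrite ltr0z.
have [k [_ hk]] := contr (divr_gt0 (ltr01) (mulr_gt0 (ltr0n R 2) nR)).
have {}hk := hk k (leqnn k); have := detR k.
have eX : n%:~R * X k = (z * u k - n * a k)%:~R.
  by rewrite mulrBr mulrA e rmorphB !rmorphM.
have eY : n%:~R * Y k = (n * b k - z * v k)%:~R.
  by rewrite mulrBr mulrA e rmorphB !rmorphM.
have hXY : n%:~R * X k + n%:~R * Y k < 1.
  rewrite -mulrDr; apply: (@le_lt_trans _ _ (n%:~R * (1 / (2 * n%:~R)))).
    by rewrite ler_pM2l.
  have -> : n%:~R * (1 / (2 * n%:~R)) = 1 / 2 :> R by field; rewrite gt_eqF.
  lra.
have sX : 0 <= n%:~R * X k by rewrite mulr_ge0 // ltW.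
have sY : 0 <= n%:~R * Y k by rewrite mulr_ge0 // ltW.
have zX : n%:~R * X k = 0.
  have : n%:~R * X k < 1 by lra.
  by move: sX; rewrite eX ler0z ltrz1 => ? ?; have -> : z * u k - n * a k = 0 by lia.
have zY : n%:~R * Y k = 0.
  have : n%:~R * Y k < 1 by lra.
  by move: sY; rewrite eY ler0z ltrz1 => ? ?; have -> : n * b k - z * v k = 0 by lia.
have {}zX : X k = 0 by apply: (mulfI (lt0r_neq0 nR)); rewrite zX mulr0.
have {}zY : Y k = 0 by apply: (mulfI (lt0r_neq0 nR)); rewrite zY mulr0.
have := U0 k; have := V0 k; move: zX zY; rewrite /X /Y => zX zY h1 h2.
have -> : Ar k = angle * U k by lra.
have -> : Br k = angle * V k by lra.
by rewrite mulrCA [V k * U k]mulrC mulrCA ltxx.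
Qed.

Lemma angle_return (e : R) : 0 < e -> exists n : int, forall i j, agree x i j 0 n ->
  exists z : int, `|angle * (i - j)%:~R - z%:~R| <= e.
Proof.
move=> e0; have [psi hpsi] := cochain_exists (Sw 0%N).
have coc k : cochain x psi (S k) (a k) (b k).
  elim: k => [//|k IH]; case: (boolP (T k)) => Tk.
    have [-> ->] := coefT Tk; case: (ST Tk) => st _.
    exact: (cochain_step (Sw k) st IH).
  have [-> ->] := coefF Tk; case: (SF Tk) => st _.
  rewrite -(swapK (S k.+1)); apply: cochain_swap.
  exact: (cochain_step (wf_swap (Sw k)) st (cochain_swap IH)).
pose H i : R := angle * i%:~R - (psi i)%:~R.
have HX k i : occa x (S k) i -> H (i + u k) = H i + X k.
  by move=> hi; have [h _] := coc k; rewrite /H h // !rmorphD /= /X /U /Ar; ring.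
have HY k i : occb x (S k) i -> H (i + v k) = H i - Y k.
  by move=> hi; have [_ h] := coc k; rewrite /H h // !rmorphD /= /Y /V /Br; ring.
have cntP k : exists c : int -> int, forall i, c (i + 1) = c i + (occ_bool x (S k) i)%:Z.
  exact: counter_exists.
pose cnt k := projT1 (cid (cntP k)).
have cntS k i : cnt k (i + 1) = cnt k i + (occ_bool x (S k) i)%:Z.
  exact: (projT2 (cid (cntP k))).
have oscs n : forall k d, 1 <= d ->
    osc x (S k) (cnt k) H d (\sum_(k <= l < k + n) cost l + d%:~R * (X (k + n) + Y (k + n))).
  elim: n => [|n IH] k d d1.
    rewrite addn0 big_geq // add0r.
    by apply: (@osc_base _ _ R _ (Sw k)) => //; [exact: HX | exact: HY | lia].
  have := IH k.+1 d d1; rewrite addSn -addnS => h.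
  rewrite (big_ltn (m := k)); last by rewrite addnS ltnS leq_addr.
  have ec : cost k = if T k then Y k else X k by [].
  rewrite -addrA addrC ec; case: (boolP (T k)) => Tk.
    case: (ST Tk) => st _.
    exact: (osc_step Hrec Hap (Sw k) st (X0 k) (Y0 k) (HX k) (HY k) (cntS k) (cntS k.+1) d1 h).
  case: (SF Tk) => st _ i j hi hj hd.
  have sw l m : occ x (swap (S l)) m <-> occ x (S l) m by apply: occ_swap.
  have bw l : occ_bool x (swap (S l)) = occ_bool x (S l).
    by apply/funext => m; apply/asbool_equiv_eq.
  have hc l : forall m, cnt l (m + 1) = cnt l m + (occ_bool x (swap (S l)) m)%:Z.
    by move=> m; rewrite bw.
  have := @osc_step _ x Hrec Hap R _ _ _ (wf_swap (Sw k)) st (fun m => - H m) (Y k) (X k)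
    (Y0 k) (X0 k) _ _ (cnt k) (cnt k.+1) (hc k) (hc k.+1) d _ d1.
  move=> /(_ _ _ _ _ j i) hh.
  have : - H j - - H i <= \sum_(k.+1 <= l < k + n.+1) cost l +
     d%:~R * (X (k + n.+1) + Y (k + n.+1)) + X k.
    apply: hh.
    - by move=> m hm; rewrite (HY k) //; ring.
    - by move=> m hm; rewrite (HX k) //; ring.
    - move=> i' j' hi' hj' hd'; rewrite opprK addrC.
      by apply: h; [exact/sw | exact/sw | rewrite distrC].
    - exact/sw.
    - exact/sw.
    - by rewrite distrC.
  lra.
have e2 : 0 < e / 2 by lra.
have [k [hk _]] := contr e2.
have small i j : occ x (S k) i -> occ x (S k) j -> H i - H j <= e.
  move=> hi hj; pose d : int := `|cnt k i - cnt k j| + 1.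
  have d1 : 1 <= d by rewrite /d; lia.
  have d0 : 0 < d%:~R :> R by rewrite ltr0z; lia.
  have [l [_ hl]] := contr (divr_gt0 e2 d0).
  have := oscs l k d d1 i j hi hj; rewrite {1}/d => hh.
  have := hl (k + l)%N (leq_addl _ _); rewrite ler_pdivlMr // => h1.
  have := hk l; have := hh _; rewrite lerDl => /(_ isT); lra.
have [L HL] := Hrec (sa (S k)) (sq (S k)).
exists (L + sq (S k)) => i j hij.
have [t [t1 t2 t3]] := HL i.
have ht' : occ x (S k) (t - i + j).
  apply: (agree_trans _ t3); apply: agree_sym.
  by apply: (agree_shift hij (s := t - i)); lia.
exists (psi t - psi (t - i + j)).
have e1 : angle * (i - j)%:~R - (psi t - psi (t - i + j))%:~R = H t - H (t - i + j).
  by rewrite /H !(rmorphD, rmorphB, rmorphN) /=; ring.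
rewrite e1 ler_norml; apply/andP; split; last exact: small.
by have := small _ _ ht' t3; lra.
Qed.

End Frequency.

(** * Minimal subshifts *)

Import numFieldNormedType.Exports.
Local Open Scope classical_set_scope.

Section Cylinders.
Variable A : finType.
Implicit Types (x y z : fullshift A) (X Y : set (fullshift A)).

Definition close_on (n : nat) z y := forall t : int, `|t| <= n%:Z -> y t = z t.

Lemma eval_near z (t : int) : \forall y \near z, y t = z t.
Proof.
have h := @proj_continuous int (fun _ => discrete_topology A) t z.
exact: (h [set z t] (discrete_set1 (z t))).
Qed.

Lemma cylinder_near z n : \forall y \near z, close_on n z y.
Proof.
elim: n => [|n IH].
  apply: filterS (eval_near z 0) => y h t t0.
  by have -> : t = 0 by lia.
apply: filterS2 (filterI IH (eval_near z n.+1%:Z)) (eval_near z (- n.+1%:Z)).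
move=> y [h1 h2] h3 t ht.
have [le|] := boolP (`|t| <= n%:Z); first exact: h1.
move=> gt; have [->|->] : t = n.+1%:Z \/ t = - n.+1%:Z by lia.
  exact: h2.
exact: h3.
Qed.

Lemma cylinder_basis z (U : set (fullshift A)) : nbhs z U ->
  exists n, forall y, close_on n z y -> U y.
Proof.
pose F : set_system (fullshift A) := filter_from setT (fun n => [set y | close_on n z y]).
have FF : Filter F.
  apply: filter_fromT_filter; first by exists 0%N.
  move=> n m; exists (maxn n m) => y h; split=> t ht; apply: h; lia.
suff : F --> z by move=> /(_ U) h /h [n _ hn]; exists n => y; apply: hn.
apply/cvg_sup => t; apply/cvg_image.
  by rewrite eqEsubset; split => // a _; exists (fun _ => a).
move=> V /nbhs_singleton Vz; exists [set y | V (y t)].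
  by exists (absz t) => // y hy /=; rewrite hy //; lia.
rewrite eqEsubset; split=> [b [y ht <-]//|b Vb].
by exists (fun _ => b).
Qed.

Lemma closed_cylinders X : closed X <->
  forall z, (forall n, exists2 y, X y & close_on n z y) -> X z.
Proof.
split=> [cX z h|h z hz].
  apply: cX => U /cylinder_basis [n hn]; have [y Xy hy] := h n.
  by exists y; split=> //; apply: hn.
by apply: h => n; have [y [Xy hy]] := hz _ (cylinder_near z n); exists y.
Qed.

Lemma fullshift_compact : compact [set: fullshift A].
Proof.
have -> : [set: fullshift A] = [set f | forall i : int, [set: discrete_topology A] (f i)].
  by rewrite eqEsubset; split.
have fA : @finite_set (discrete_topology A) setT := @finite_finset A setT.
exact: (@tychonoff int (fun _ => discrete_topology A) (fun _ => setT)
  (fun _ => finite_compact fA)).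
Qed.

End Cylinders.

Section MinimalSubshift.
Variables (A : finType) (X : set (fullshift A)).
Implicit Types (x y z : fullshift A).

Definition shift_by (i : int) (z : fullshift A) : fullshift A := fun n => z (n + i).

Lemma shift_by_left i z : shift_by (i + 1) z = left_shift (shift_by i z).
Proof. by apply/funext => n; rewrite /shift_by /left_shift addrAC addrA. Qed.

Lemma shift_by0 z : shift_by 0 z = z.
Proof. by apply/funext => n; rewrite /shift_by addr0. Qed.

Lemma subshift_shift i z : subshift X -> X z -> X (shift_by i z).
Proof.
move=> [_ hX] Xz; have fwd y : X y -> X (left_shift y) by move=> h; rewrite -hX; exists y.
have bwd y : X (left_shift y) -> X y.
  move=> h; have : (@left_shift A @` X) (left_shift y) by rewrite hX.
  move=> [y' Xy' e]; have -> // : y = y'.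
  apply/funext => n; have := congr1 (fun z : fullshift A => z (n - 1)) e.
  by rewrite /left_shift subrK.
have pos (n : nat) : X (shift_by n%:Z z).
  elim: n => [|n IH]; first by rewrite shift_by0.
  have -> : n.+1%:Z = n%:Z + 1 by lia.
  by rewrite shift_by_left; apply: fwd.
have neg (n : nat) : X (shift_by (- n%:Z) z).
  elim: n => [|n IH]; first by rewrite oppr0 shift_by0.
  apply: bwd; rewrite -shift_by_left.
  by have -> : - n.+1%:Z + 1 = - n%:Z by lia.
have [->|->] : i = (absz i)%:Z \/ i = - (absz i)%:Z by lia.
  exact: pos.
exact: neg.
Qed.

Definition occurs_at (n : int) y j z i := forall t, 0 <= t -> t < n -> z (i + t) = y (j + t).

Hypothesis Xmin : minimal_subshift X.

Lemma minimal_occurs x y j n : X x -> X y -> exists i, occurs_at n y j x i.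
Proof.
have [[Xc Xs] Xm] := Xmin.
move=> Xx Xy; apply: contrapT => hno.
pose Y := X `&` [set z | forall i, ~ occurs_at n y j z i].
apply: (Xm Y).
- split.
    apply/closed_cylinders => z hz; split.
      apply: (closed_cylinders X).1 => // m; have [y' [Xy' _] h] := hz m.
      by exists y'.
    move=> i h; have [y' [_ h1] h2] := hz (absz i + absz n)%N.
    by apply: (h1 i) => t t0 t1; rewrite h2 ?h //; lia.
  rewrite eqEsubset; split.
    move=> _ [z [Xz hz] <-]; split; first by rewrite -Xs; exists z.
    move=> i h; apply: (hz (i + 1)) => t t0 t1.
    by rewrite -h // /left_shift; congr z; lia.
  move=> z [Xz hz]; have : (@left_shift A @` X) z by rewrite Xs.
  move=> [z' Xz' e]; exists z' => //; split=> // i h; apply: (hz (i - 1)) => t t0 t1.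
  by rewrite -e -h // /left_shift; congr z'; lia.
- by exists x; split=> // i h; apply: hno; exists i.
- split; first by move=> z [].
  move=> /(_ _ Xy) [_ /(_ j)]; apply.
  by [].
Qed.

Variable x : fullshift A.
Hypothesis Xx : X x.

Lemma minimal_recurrent : recurrent x.
Proof.
move=> i n; apply: contrapT => /forallNP hno.
have hno' L : exists t, forall j, t <= j -> j < t + L -> ~ agree x j i 0 n.
  have /existsNP [t ht] := hno L; exists t => j h1 h2 h3; apply: ht.
  by exists j.
pose tL (L : nat) : int := projT1 (cid (hno' (2 * L%:Z))).
have tLP L : forall j, tL L <= j -> j < tL L + 2 * L%:Z -> ~ agree x j i 0 n.
  exact: (projT2 (cid (hno' (2 * L%:Z)))).
have [Xsub _] := Xmin; have [Xc _] := Xsub.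
have Xk : compact X.
  by apply: (subclosed_compact Xc (@fullshift_compact A)).
pose f (L : nat) := shift_by (tL L + L%:Z) x.
have [|z [Xz hz]] := Xk (f @ \oo) _.
  by exists 0%N => // L _; apply: subshift_shift.
have [k hk] := minimal_occurs i n Xz Xx.
have [_ [[L /= hL <-] hc]] : (f @` [set L | (absz k < L)%N]) `&`
    close_on (absz k + absz n)%N z !=set0.
  apply: hz; last exact: cylinder_near.
  by exists (absz k).+1 => // L /= hL; exists L.
apply: (tLP L (k + (tL L + L%:Z))); [lia|lia|].
move=> t t0 t1; rewrite -hk //.
have -> : x (k + (tL L + L%:Z) + t) = f L (k + t).
  by rewrite /f /shift_by; congr x; lia.
by apply: hc; lia.
Qed.


Lemma minimal_not_right_periodic : infinite_set X -> not_right_periodic x.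
Proof.
move=> Xinf i P P0 hx; apply: Xinf.
have perx t : x (t + P) = x t.
  have [L HL] := minimal_recurrent t (P + 1).
  have [j [j1 _ hj]] := HL i.
  by rewrite -hj; [rewrite hx // -[in RHS](addr0 t) -hj ?addr0 //| |]; lia.
have per y : X y -> forall t, y (t + P) = y t.
  move=> Xy t; have [k hk] := minimal_occurs t (P + 1) Xx Xy.
  by rewrite -[in RHS](addr0 t) -!hk ?addr0 ?perx //; lia.
pose p := absz P.
pose g (f : {ffun 'I_p.-1.+1 -> A}) : fullshift A := fun t => f (inord (absz (t %% P)%Z)).
apply: (@sub_finite_set _ _ (g @` setT)); last exact: finite_image.
move=> y Xy; exists [ffun k : 'I_p.-1.+1 => y (k : nat)%:Z] => //.
apply/funext => t; rewrite /g ffunE inordK; last first.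
  by have := ltz_pmod t P0; have := modz_ge0 t (lt0r_neq0 P0); lia.
have -> : (absz (t %% P)%Z)%:Z = (t %% P)%Z by have := modz_ge0 t (lt0r_neq0 P0); lia.
have mul (k : nat) s : y (s + k%:Z * P) = y s.
  elim: k => [|k IH]; first by rewrite mul0r addr0.
  have -> : s + k.+1%:Z * P = s + k%:Z * P + P by lia.
  by rewrite per.
have e := divz_eq t P; set d := (t %/ P)%Z in e *; set r := (t %% P)%Z in e *.
have [dE|dE] : d = (absz d)%:Z \/ d = - (absz d)%:Z by lia.
  by rewrite e dE addrC mul.
by rewrite -(mul (absz d) t) {1}e dE; congr y; lia.
Qed.

Lemma complexity_factors q : complexity X q = nfactors x q.
Proof.
apply: eq_card => w; rewrite inE; apply/idP/asboolP.
  rewrite unfold_in /= => /asboolP [y Xy [i hi]].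
  have [k hk] := minimal_occurs i q%:Z Xx Xy.
  exists (k + q%:Z); apply: eq_from_tnth => j; rewrite hi tnth_mktuple.
  by rewrite addrK hk // ltz_nat.
move=> [e ->]; apply/asboolP; exists x => //; exists (e - q%:Z) => j.
by rewrite tnth_mktuple.
Qed.

End MinimalSubshift.

Lemma irrational_angle_exists (R : realType) (A : finType) (x : int -> A) (N Q0 : nat) :
  recurrent x -> not_right_periodic x -> (4 <= N)%N ->
  (forall Q, (Q0 <= Q)%N -> (2 * N * nfactors x Q <= (3 * N - 2) * Q)%N) ->
  exists2 gamma : R, irrational gamma &
    forall e : R, 0 < e -> exists n : int, forall i j, agree x i j 0 n ->
      exists z : int, `|gamma * (i - j)%:~R - z%:~R| <= e.
Proof.
move=> Hrec Hap N4 Hp; pose B := maxn Q0 (3 * N).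
have [q1 Bq1 Hq1] : exists2 q1, (B <= q1)%N & (nfactors x q1.+1 <= (nfactors x q1).+1)%N.
  apply: contrapT => hno.
  have grow k : (2 * k <= nfactors x (B + k))%N.
    elim: k => [//|k IH]; rewrite addnS.
    have : ~~ (nfactors x (B + k).+1 <= (nfactors x (B + k)).+1)%N.
      by apply/negP => h; apply: hno; exists (B + k)%N => //; apply: leq_addr.
    lia.
  have h1 := grow (3 * B)%N; have h2 := Hp (B + 3 * B)%N.
  have {}h2 : (2 * N * nfactors x (B + 3 * B) <= (3 * N - 2) * (B + 3 * B))%N.
    by apply: h2; rewrite /B; lia.
  have h3 : (2 * N * (2 * (3 * B)) <= 2 * N * nfactors x (B + 3 * B))%N.
    by rewrite leq_mul2l h1 orbT.
  have h4 : ((3 * N - 2) * (B + 3 * B) < 2 * N * (2 * (3 * B)))%N.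
    have -> : (2 * N * (2 * (3 * B)) = (3 * N) * (B + 3 * B))%N by lia.
    by rewrite ltn_mul2r /B; lia.
  lia.
have [s [w sq1 hs]] := state_exists Hrec Hap Hq1.
pose q0 := absz (sq s).
have Hq0 Q : (q0 <= Q)%N -> (2 * N * nfactors x Q <= (3 * N - 2) * Q)%N.
  by move=> h; apply: Hp; rewrite /q0 in h; lia.
have g : good x q0 s 0.
  split=> //; first by rewrite /q0; lia.
    by move=> Q h1 h2; rewrite /excess; move: hs; rewrite -/q0 /q0; lia.
  by have := wf_excess w; have := wf_u w; have := wf_v w; rewrite /excess; lia.
have q0N : (3 * N <= q0)%N by rewrite /q0; lia.
have [S [M [S0 SK Sn]]] := hierarchy_exists Hrec Hap N4 q0N Hq0 g.
have Sw k : wf x (S k) by have [K /good_wf] := SK k.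
exists (angle x R N S M); last first.
  by move=> e; apply: angle_return.
move=> [r _ hr]; apply: (@angle_irrational _ x Hrec R N S M N4 Sw Sn (denq r) (numq r)).
  exact: denq_gt0.
rewrite -hr /ratr mulrC divfK // intr_eq0; exact: denq_neq0.
Qed.

Section Eigenfunction.
Variables (R : realType) (A : finType) (X : set (fullshift A)) (x : fullshift A).
Hypotheses (Xmin : minimal_subshift X) (Xx : X x).
Variable gamma : R.
Hypothesis Hg : forall e : R, 0 < e -> exists n : int, forall i j, agree x i j 0 n ->
  exists z : int, `|gamma * (i - j)%:~R - z%:~R| <= e.

Let theta : R := 2 * pi * gamma.
Let c (i : int) : R := cos (theta * i%:~R).
Let s (i : int) : R := sin (theta * i%:~R).

Lemma cos_sin_2pi (a : R) (z : int) :
  cos (a + 2 * pi * z%:~R) = cos a /\ sin (a + 2 * pi * z%:~R) = sin a.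
Proof.
have pos (n : nat) (b : R) : cos (b + 2 * pi * n%:R) = cos b /\ sin (b + 2 * pi * n%:R) = sin b.
  elim: n => [|n [IH1 IH2]]; first by rewrite mulr0 addr0.
  have -> : b + 2 * pi * n.+1%:R = (b + 2 * pi * n%:R) + pi *+ 2.
    by rewrite -natr1 mulr2n; ring.
  by rewrite cosD2pi sinD2pi.
case: z => n; first exact: pos.
have [h1 h2] := pos n.+1 (a + 2 * pi * (Negz n)%:~R).
by rewrite -h1 -h2; split; congr (_ _); rewrite NegzE mulrNz; ring.
Qed.

Let cs_close (e : R) : 0 < e -> exists n : nat, forall i j,
  (forall t, `|t| <= n%:Z -> x (i + t) = x (j + t)) -> `|c i - c j| <= e /\ `|s i - s j| <= e.
Proof.
move=> e0; have e2 : 0 < e / 2 by lra.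
have hc : \forall r \near (0 : R), `|1 - cos r| <= e / 2.
  by have /cvgrPdist_le/(_ _ e2) := @continuous_cos R 0; rewrite cos0.
have hs : \forall r \near (0 : R), `|0 - sin r| <= e / 2.
  by have /cvgrPdist_le/(_ _ e2) := @continuous_sin R 0; rewrite sin0.
have [d /= d0 hd] := filterI hc hs.
have p0 : 0 < 2 * pi :> R by rewrite mulr_gt0 // pi_gt0.
have [n hn] := Hg (divr_gt0 d0 (mulr_gt0 (ltr0n R 2) p0)).
exists (absz n) => i j hij.
have [|z hz] := hn i j; first by move=> t t0 t1; apply: hij; lia.
pose r := 2 * pi * (gamma * (i - j)%:~R - z%:~R).
have hr : `|0 - r| < d.
  rewrite sub0r normrN normrM gtr0_norm //.
  apply: (@le_lt_trans _ _ (2 * pi * (d / (2 * (2 * pi))))); first by rewrite ler_pM2l.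
  have half (P : R) : P != 0 -> 2 * P * (d / (2 * (2 * P))) = d / 2.
    by move=> h; field.
  rewrite half; last exact: lt0r_neq0 (pi_gt0 R).
  lra.
have [h1 h2] := hd r hr.
have e1 : theta * i%:~R = theta * j%:~R + r + 2 * pi * z%:~R.
  by rewrite /r /theta rmorphB /=; ring.
have [ec es] := cos_sin_2pi (theta * j%:~R + r) z.
rewrite /c /s e1 ec es cosD sinD; set a := theta * j%:~R.
have ha : `|cos a| <= 1 by rewrite ler_norml cos_geN1 cos_le1.
have hb : `|sin a| <= 1 by rewrite ler_norml sin_geN1 sin_le1.
have bound (y w y' w' : R) : `|y| <= 1 -> `|w| <= 1 -> `|y'| <= e / 2 -> `|w'| <= e / 2 ->
    `|y * y' + w * w'| <= e.
  move=> g1 g2 g3 g4; apply: le_trans (ler_normD _ _) _; rewrite !normrM.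
  have : `|y| * `|y'| <= 1 * (e / 2) by apply: ler_pM.
  have : `|w| * `|w'| <= 1 * (e / 2) by apply: ler_pM.
  lra.
rewrite sub0r normrN in h2; rewrite -normrN opprB in h1.
split.
  have -> : cos a * cos r - sin a * sin r - cos a
    = cos a * (cos r - 1) + (- sin a) * sin r by ring.
  by apply: bound => //; rewrite ?normrN.
have -> : sin a * cos r + cos a * sin r - sin a
  = sin a * (cos r - 1) + cos a * sin r by ring.
exact: bound.
Qed.

Let pos_exists z (n : nat) : exists i, X z -> forall t, `|t| <= n%:Z -> x (i + t) = z t.
Proof.
have [Xz|] := pselect (X z); last by exists 0.
have [i hi] := minimal_occurs Xmin (- n%:Z) (2 * n%:Z + 1) Xx Xz.
exists (i + n%:Z) => _ t ht; have -> : i + n%:Z + t = i + (n%:Z + t) by lia.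
by rewrite hi; [congr z|..]; lia.
Qed.

Let pos z n : int := projT1 (cid (pos_exists z n)).

Let posP z n : X z -> forall t, `|t| <= n%:Z -> x (pos z n + t) = z t.
Proof. exact: (projT2 (cid (pos_exists z n))). Qed.

Let limit_exists (g : int -> R) : (forall e, 0 < e -> exists n : nat, forall i j,
    (forall t, `|t| <= n%:Z -> x (i + t) = x (j + t)) -> `|g i - g j| <= e) ->
  exists G : fullshift A -> R, forall e, 0 < e -> exists n : nat, forall z i, X z ->
    (forall t, `|t| <= n%:Z -> x (i + t) = z t) -> `|G z - g i| <= e.
Proof.
move=> hg; exists (fun z => lim ((fun n => g (pos z n)) @ \oo)) => e e0.
have e2 : 0 < e / 2 by lra.
have [n hn] := hg _ e2; exists n => z i Xz hi.
have cv : cvg ((fun n => g (pos z n)) @ \oo).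
  apply: cauchy_cvg; apply/cauchy_ballP => d d0.
  have d2 : 0 < d / 2 by lra.
  have [m hm] := hg _ d2.
  exists ([set y | exists2 k, (m <= k)%N & y = g (pos z k)],
          [set y | exists2 k, (m <= k)%N & y = g (pos z k)]).
    by split; exists m => // k /= mk; exists k.
  move=> [_ _] [/= [k mk ->] [l ml ->]]; rewrite /ball /=.
  apply: (@le_lt_trans _ _ (d / 2)); last lra.
  apply: hm => t ht; rewrite !posP //; lia.
have /cvgrPdist_le/(_ _ e2) [m _ hm] := cv.
have {}hm := hm (maxn n m) (leq_maxr _ _); rewrite /= in hm.
have h : `|g (pos z (maxn n m)) - g i| <= e / 2.
  by apply: hn => t ht; rewrite posP ?hi //; lia.
have -> : lim ((fun n => g (pos z n)) @ \oo) - g i =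
  (lim ((fun n => g (pos z n)) @ \oo) - g (pos z (maxn n m))) +
  (g (pos z (maxn n m)) - g i) by ring.
by apply: le_trans (ler_normD _ _) _; lra.
Qed.

Lemma eigenvalue_of_returns : continuous_eigenvalue X gamma.
Proof.
have [C hC] : exists C : fullshift A -> R, forall e, 0 < e -> exists n : nat, forall z i, X z ->
    (forall t, `|t| <= n%:Z -> x (i + t) = z t) -> `|C z - c i| <= e.
  apply: limit_exists => e /cs_close [n hn]; exists n => i j h; by case: (hn i j h).
have [S hS] : exists C : fullshift A -> R, forall e, 0 < e -> exists n : nat, forall z i, X z ->
    (forall t, `|t| <= n%:Z -> x (i + t) = z t) -> `|C z - s i| <= e.
  apply: limit_exists => e /cs_close [n hn]; exists n => i j h; by case: (hn i j h).
have [Xsub _] := Xmin.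
exists (fun z => (C z +i* S z)%C : Cplx R); split.
- apply/subspace_continuousP => z Xz; apply/cvgrPdist_le => eps eps0.
  have [e e0 ee] : exists2 e : R, 0 < e & eps = (e%:C)%C.
    move: eps0; case: eps => re im; rewrite ltcE /= => /andP[/eqP hi hr].
    by exists re => //; rewrite hi.
  have e4 : 0 < e / 4 by lra.
  have [n hn] := hC _ e4; have [m hm] := hS _ e4.
  have near := cylinder_near z (maxn n m).
  apply: filterS near => y hy Xy.
  have [i hi] := pos_exists z (maxn n m); have {}hi := hi Xz.
  have hiy t : `|t| <= (maxn n m)%:Z -> x (i + t) = y t by move=> ht; rewrite hy ?hi.
  have h1 : `|C z - c i| <= e / 4 by apply: hn => // t ht; apply: hi; lia.
  have h2 : `|C y - c i| <= e / 4 by apply: hn => // t ht; apply: hiy; lia.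
  have h3 : `|S z - s i| <= e / 4 by apply: hm => // t ht; apply: hi; lia.
  have h4 : `|S y - s i| <= e / 4 by apply: hm => // t ht; apply: hiy; lia.
  rewrite ee normc_def /= lecR.
  rewrite -[leRHS]gtr0_norm // -sqrtr_sqr ler_sqrt ?sqr_ge0 //.
  move: h1 h2 h3 h4; rewrite !ler_norml => /andP[? ?] /andP[? ?] /andP[? ?] /andP[? ?].
  have hq (r : R) : - (e / 2) <= r -> r <= e / 2 -> r ^+ 2 <= (e / 2) ^+ 2.
    by move=> r1 r2; rewrite -ler_sqrt ?sqr_ge0 // !sqrtr_sqr [leRHS]gtr0_norm ?ler_norml ?r1 //; lra.
  have k1 := hq (C z - C y); have k2 := hq (S z - S y).
  have {}k1 : (C z - C y) ^+ 2 <= (e / 2) ^+ 2 by apply: k1; lra.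
  have {}k2 : (S z - S y) ^+ 2 <= (e / 2) ^+ 2 by apply: k2; lra.
  have : (e / 2) ^+ 2 = e ^+ 2 / 4 by field.
  have : 0 <= e ^+ 2 by rewrite sqr_ge0.
  lra.
- exists x => //; apply/eqP => h.
  have hh : 0 < 1 / 2 :> R by lra.
  have [n hn] := hC _ hh.
  have := hn x 0 Xx; rewrite /c mulr0 cos0 => h1.
  have {}h1 : `|C x - 1| <= 1 / 2 by apply: h1 => t _; rewrite add0r.
  have e : C x = 0 by case: h.
  by move: h1; rewrite e sub0r normrN normr1; lra.
- move=> z Xz.
  have Xsz : X (left_shift z).
    by rewrite -(shift_by0 z) -shift_by_left; apply: subshift_shift.
  have close (e : R) : 0 < e ->
      `|C (left_shift z) - (cos theta * C z - sin theta * S z)| <= e /\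
      `|S (left_shift z) - (cos theta * S z + sin theta * C z)| <= e.
    move=> e0; have e3 : 0 < e / 3 by lra.
    have [n hn] := hC _ e3; have [m hm] := hS _ e3.
    have [i hi] := pos_exists z (maxn n m).+1; have {}hi := hi Xz.
    have hiy t : `|t| <= (maxn n m)%:Z -> x (i + 1 + t) = left_shift z t.
      move=> ht; rewrite /left_shift -hi; last lia.
      by congr x; lia.
    have h1 : `|C z - c i| <= e / 3 by apply: hn => // t ht; apply: hi; lia.
    have h2 : `|C (left_shift z) - c (i + 1)| <= e / 3.
      by apply: hn => // t ht; apply: hiy; lia.
    have h3 : `|S z - s i| <= e / 3 by apply: hm => // t ht; apply: hi; lia.
    have h4 : `|S (left_shift z) - s (i + 1)| <= e / 3.
      by apply: hm => // t ht; apply: hiy; lia.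
    have ec : c (i + 1) = cos theta * c i - sin theta * s i.
      by rewrite /c /s rmorphD /= mulrDr mulr1 cosD; ring.
    have es : s (i + 1) = cos theta * s i + sin theta * c i.
      by rewrite /c /s rmorphD /= mulrDr mulr1 sinD; ring.
    have ha : `|cos theta| <= 1 by rewrite ler_norml cos_geN1 cos_le1.
    have hb : `|sin theta| <= 1 by rewrite ler_norml sin_geN1 sin_le1.
    have bound (a b p q r : R) : `|a| <= 1 -> `|b| <= 1 -> `|p| <= e / 3 ->
        `|q| <= e / 3 -> `|r| <= e / 3 -> `|p + (a * q + b * r)| <= e.
      move=> g1 g2 g3 g4 g5; apply: le_trans (ler_normD _ _) _.
      have := ler_normD (a * q) (b * r); rewrite !normrM.
      have : `|a| * `|q| <= 1 * (e / 3) by apply: ler_pM.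
      have : `|b| * `|r| <= 1 * (e / 3) by apply: ler_pM.
      lra.
    rewrite distrC in h1; rewrite distrC in h3.
    split.
      have -> : C (left_shift z) - (cos theta * C z - sin theta * S z) =
        (C (left_shift z) - c (i + 1)) + (cos theta * (c i - C z) + (- sin theta) * (s i - S z)).
        by rewrite ec; ring.
      by apply: bound => //; rewrite normrN.
    have -> : S (left_shift z) - (cos theta * S z + sin theta * C z) =
      (S (left_shift z) - s (i + 1)) + (cos theta * (s i - S z) + sin theta * (c i - C z)).
      by rewrite es; ring.
    exact: bound.
  have zero (r : R) : (forall e, 0 < e -> `|r| <= e) -> r = 0.
    move=> h; apply/eqP; rewrite -normr_le0; apply/ler_addgt0Pl => e e0.
    by rewrite addr0; apply: h.
  have zC := zero _ (fun e e0 => (close e e0).1).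
  have zS := zero _ (fun e e0 => (close e e0).2).
  apply/eqP; rewrite eq_complex /= -/theta.
  by apply/andP; split; apply/eqP; lra.
Qed.

End Eigenfunction.

Lemma limsup_complexity_lower (R : realType) (A : finType) (X : set (fullshift A)) :
  minimal_subshift X -> infinite_set X ->
  ~ (exists2 gamma : R, irrational gamma & continuous_eigenvalue X gamma) ->
  ((3 / 2)%:E <= limsup_complexity R X)%E.
Proof.
move=> Xmin Xinf; apply: contra_notP => /negP; rewrite -ltNge => hlt.
have [x Xx] : X !=set0 by apply: infinite_setN0.
have Hrec := minimal_recurrent Xmin Xx.
have Hap := minimal_not_right_periodic Xmin Xx Xinf.
have [r r32 [Q1 hQ1]] : exists2 r : R, r < 3 / 2 & exists Q1, forall q, (Q1 <= q)%N ->
    (complexity X q)%:R / q%:R <= r.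
  move: hlt; rewrite /limsup_complexity /limn_esup limf_esupE => /ereal_inf_lt.
  move=> [_ [V [Q1 _ hV] <-] hs].
  set S := ereal_sup _ in hs.
  have ub q : (Q1 <= q)%N -> (((complexity X q)%:R / q%:R : R)%:E <= S)%E.
    by move=> h; apply: ereal_sup_ubound; exists q => //; apply: hV.
  have S0 := ub Q1 (leqnn Q1).
  have e : S = (fine S)%:E by move: hs S0; case: (S).
  exists (fine S); first by move: hs; rewrite {1}e lte_fin.
  by exists Q1 => q /ub; rewrite e lee_fin.
have d0 : 0 < 3 / 2 - r by rewrite subr_gt0.
pose N := (maxn 4 (Num.truncn (3 / 2 - r)^-1).+1)%N.
have N4 : (4 <= N)%N by rewrite leq_maxl.
have N0 : 0 < N%:R :> R by rewrite ltr0n; lia.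
have hN : N%:R^-1 <= 3 / 2 - r.
  rewrite -[leRHS]invrK lef_pV2 ?posrE ?invr_gt0 //.
  apply/ltW/(lt_le_trans (truncnS_gt _)); rewrite ler_nat; exact: leq_maxr.
have hp Q : (maxn Q1 1 <= Q)%N -> (2 * N * nfactors x Q <= (3 * N - 2) * Q)%N.
  rewrite geq_max => /andP [h1 h2].
  have q0 : 0 < Q%:R :> R by rewrite ltr0n.
  have := hQ1 _ h1; rewrite (complexity_factors Xmin Xx) ler_pdivrMr // => hp.
  have {}hp : (nfactors x Q)%:R <= (3 / 2 - N%:R^-1) * Q%:R :> R.
    by apply: (le_trans hp); rewrite ler_pM2r //; lra.
  rewrite -(ler_nat R) !natrM natrB ?natrM; last lia.
  have := ler_wpM2l (ltW N0) hp.
  have -> : N%:R * ((3 / 2 - N%:R^-1) * Q%:R) = (3 * N%:R / 2 - 1) * Q%:R :> R.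
    by field; rewrite gt_eqF.
  lra.
have [gamma irr hg] := @irrational_angle_exists R A x N _ Hrec Hap N4 hp.
exists gamma => //; by apply: (eigenvalue_of_returns Xmin Xx).
Qed.

(** * A Toeplitz subshift *)

Section Toeplitz.

Definition period (k : nat) : int := (k.+1)`!%:Z.

Definition multiple (k : nat) (i : int) : Prop := exists c, i = c * period k.

Lemma period_gt0 k : 0 < period k.
Proof. by rewrite /period ltz_nat fact_gt0. Qed.

Lemma periodS k : period k.+1 = k.+2%:Z * period k.
Proof. by rewrite /period factS PoszM. Qed.

Lemma period_ge k : k.+1%:Z <= period k.
Proof.
elim: k => [|k IH]; first by [].
have p0 := period_gt0 k; rewrite periodS; nia.
Qed.

Lemma period_dvd k l : (k <= l)%N -> exists c, period l = c * period k.
Proof.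
elim: l => [|l IH].
  by case: k => // _; exists 1; rewrite mul1r.
rewrite leq_eqVlt ltnS => /predU1P [->|/IH [c e]]; first by exists 1; rewrite mul1r.
by exists (l.+2%:Z * c); rewrite periodS e mulrA.
Qed.

Lemma period_le k l : (k <= l)%N -> period k <= period l.
Proof.
move=> /period_dvd [c e]; have := period_gt0 l; rewrite e => h.
have := period_gt0 k => p0; have c0 : 0 < c by rewrite -(pmulr_lgt0 _ p0).
nia.
Qed.

Lemma multiple_le k l i : (k <= l)%N -> multiple l i -> multiple k i.
Proof. by move=> /period_dvd [c e] [d ->]; exists (d * c); rewrite e mulrA. Qed.

Lemma multipleB k i j : multiple k i -> multiple k j -> multiple k (i - j).
Proof. by move=> [c ->] [d ->]; exists (c - d); rewrite mulrBl. Qed.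

Lemma multipleD k i j : multiple k i -> multiple k j -> multiple k (i + j).
Proof. by move=> [c ->] [d ->]; exists (c + d); rewrite mulrDl. Qed.

Lemma multiple_small k i : multiple k i -> `|i| < period k -> i = 0.
Proof.
move=> [c ->]; rewrite normrM [`|period k|]gtr0_norm ?period_gt0 //.
have := period_gt0 k => p0 h; have [->|c0] := eqVneq c 0; first by rewrite mul0r.
have : 1 <= `|c| by lia.
nia.
Qed.

Definition toeplitz : fullshift bool := fun i =>
  `[< exists k : nat, [/\ odd k, multiple k i & ~ multiple k.+1 i] >].

Local Notation x := toeplitz.

Lemma toeplitzE k i : multiple k i -> ~ multiple k.+1 i -> x i = odd k.
Proof.
move=> h1 h2; apply/asboolP/idP => [[l [ol h3 h4]]|ok]; last by exists k.
have -> // : k = l.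
by case: (ltngtP k l) => // c; [case: h2 | case: h4]; apply: multiple_le; eassumption.
Qed.

Lemma toeplitz0 : x 0 = false.
Proof. by apply/asboolPn => -[k [_ _ []]]; exists 0; rewrite mul0r. Qed.

Lemma toeplitz_shift k i j : multiple k j -> ~ multiple k i -> x (i + j) = x i.
Proof.
move=> hj hi; have [l lk [h1 h2]] : exists2 l, (l < k)%N & multiple l i /\ ~ multiple l.+1 i.
  elim: k hi {hj} => [|k IH] hi; first by case: hi; exists i; rewrite mulr1.
  have [h|h] := pselect (multiple k i); first by exists k.
  by have [l lk hl] := IH h; exists l => //; apply: leq_trans lk _.
rewrite (toeplitzE h1 h2); apply: toeplitzE.
  by apply: multipleD => //; apply: multiple_le hj; apply: ltnW.
move=> h; apply: h2; have -> : i = i + j - j by rewrite addrK.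
by apply: multipleB => //; apply: multiple_le hj.
Qed.

(* For even k the letter at the position [period k + c * period k.+1] agrees with
   the exceptional letter at 0. *)
Lemma toeplitz_return k (c : int) i : ~~ odd k -> `|i| < period k ->
  x (i + (period k + c * period k.+1)) = x i.
Proof.
move=> ek hi; have hm : multiple k (period k + c * period k.+1).
  by exists (1 + c * k.+2%:Z); rewrite periodS; ring.
have [->|i0] := eqVneq i 0; last first.
  by apply: toeplitz_shift hm _ => h; have := multiple_small h hi; lia.
rewrite add0r toeplitz0 (toeplitzE hm) ?(negPf ek) //.
move=> [d]; rewrite periodS => e; have p0 := period_gt0 k.
have : (1 + c * k.+2%:Z) * period k = (d * k.+2%:Z) * period k.
  by rewrite mulrDl mul1r -!mulrA.
move/(mulIf (lt0r_neq0 p0)) => h.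
have {}h : (d - c) * k.+2%:Z = 1 by lia.
by move/(congr1 absz): h; rewrite abszM => /eqP; rewrite muln_eq1 andbF.
Qed.

Definition even_above (n : nat) : exists k, ~~ odd k /\ (n <= k)%N.
Proof. by exists n.*2; rewrite odd_double; lia. Qed.

Lemma toeplitz_recurrent : recurrent x.
Proof.
move=> i n; have [k [ek nk]] := even_above (absz i + absz n)%N.
have pk := period_ge k; have P0 := period_gt0 k.+1.
exists (period k.+1) => t.
pose c := ((t + period k.+1 - 1 - i - period k) %/ period k.+1)%Z.
have hc := divz_eq (t + period k.+1 - 1 - i - period k) (period k.+1).
have h1 := ltz_pmod (t + period k.+1 - 1 - i - period k) P0.
have h2 := modz_ge0 (t + period k.+1 - 1 - i - period k) (lt0r_neq0 P0).
rewrite -/c in hc.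
exists (i + (period k + c * period k.+1)); split; [lia|lia|].
move=> s s0 s1; have -> : i + (period k + c * period k.+1) + s =
  (i + s) + (period k + c * period k.+1) by ring.
by apply: toeplitz_return => //; lia.
Qed.

Definition toeplitz_shiftspace : set (fullshift bool) :=
  [set z | forall j n, exists i, occurs_at n z j x i].

Local Notation X := toeplitz_shiftspace.

Lemma toeplitz_in : X x.
Proof. by move=> j n; exists j. Qed.

Lemma toeplitz_shift_in i : X (shift_by i x).
Proof. by move=> j n; exists (j + i) => t _ _; rewrite /shift_by; congr x; lia. Qed.

Lemma toeplitz_subshift : subshift X.
Proof.
split.
  apply/closed_cylinders => z hz j n.
  have [y Xy hy] := hz (absz j + absz n)%N; have [i hi] := Xy j n.
  by exists i => t t0 t1; rewrite hi // hy //; lia.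
have shiftX i z : X z -> X (shift_by i z).
  move=> Xz j n; have [k hk] := Xz (j + i) n; exists k => t t0 t1.
  by rewrite hk // /shift_by; congr z; lia.
rewrite eqEsubset; split=> z.
  by move=> [y Xy <-]; rewrite -(shift_by0 y) -shift_by_left; apply: shiftX.
move=> Xz; exists (shift_by (-1) z); first exact: shiftX.
by rewrite -shift_by_left addNr shift_by0.
Qed.

Lemma toeplitz_minimal : minimal_subshift X.
Proof.
split; first exact: toeplitz_subshift.
move=> Y Ysub [z Yz] [YX]; apply => z' Xz'.
have Yc : closed Y by case: Ysub.
apply: (closed_cylinders Y).1 => // n.
have [i hi] := Xz' (- n%:Z) (2 * n%:Z + 1).
have [L HL] := toeplitz_recurrent i (2 * n%:Z + 1).
have [k hk] := YX _ Yz 0 (L + 2 * n%:Z + 1).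
have [m [m1 m2 hm]] := HL k.
exists (shift_by (m - k + n%:Z) z); first exact: subshift_shift.
move=> t ht; rewrite /shift_by.
have -> : t + (m - k + n%:Z) = 0 + (t + (m - k + n%:Z)) by lia.
rewrite -hk; [|lia|lia].
have -> : k + (t + (m - k + n%:Z)) = m + (n%:Z + t) by lia.
rewrite hm; [|lia|lia].
rewrite hi; [|lia|lia].
by congr z'; lia.
Qed.

Lemma toeplitz_aperiodic P : 0 < P -> ~ (forall t, x (t + P) = x t).
Proof.
move=> P0 h; have [k [ek nk]] := even_above (absz P).
have mul (n : nat) : x (n%:Z * P) = x 0.
  elim: n => [|n IH]; first by rewrite mul0r.
  have -> : n.+1%:Z * P = n%:Z * P + P by lia.
  by rewrite h.
have [c hc] : exists c : nat, period k.+1 = c%:Z * P.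
  have : (absz P %| (k.+2)`!)%N by apply: dvdn_fact; lia.
  move/dvdnP => [c e]; exists c; rewrite /period e PoszM; congr (_ * _); lia.
have : x (period k.+1) = odd k.+1.
  apply: toeplitzE; first by exists 1; rewrite mul1r.
  by move=> /multiple_small; have := period_gt0 k.+1; rewrite [period k.+2]periodS; nia.
by rewrite hc mul toeplitz0 /= ek.
Qed.

Lemma toeplitz_infinite : infinite_set X.
Proof.
move=> Xfin; have inj : injective (fun n : nat => shift_by n%:Z x).
  move=> n m; wlog nm : n m / (n <= m)%N.
    by move=> H e; case: (leqP n m) => c; [exact: H | apply/esym/H => //; exact: ltnW].
  move=> e; have [//|ne] := eqVneq n m; exfalso.
  apply: (@toeplitz_aperiodic (m%:Z - n%:Z)); first lia.
  move=> t; have := congr1 (fun z : fullshift bool => z (t - n%:Z)) e.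
  by rewrite /shift_by subrK => ->; congr x; lia.
apply: infinite_nat.
have e : ([set shift_by n%:Z x | n in [set: nat]] #= [set: nat])%card.
  by apply: inj_card_eq => n m _ _; apply: inj.
rewrite -(eq_finite_set e); apply: sub_finite_set Xfin => _ [n _ <-].
exact: toeplitz_shift_in.
Qed.

End Toeplitz.

Section ToeplitzComplexity.
Local Notation x := toeplitz.
Local Notation X := toeplitz_shiftspace.

Variables (k q : nat).
Hypothesis hq : q%:Z <= 2 * period k.+1.

(* A window of length q shows at most two multiples of [period k.+1] whose letter
   is not [odd k]; the words below are those with none, one and two of them. *)
Let word (g : int -> bool) : q.-tuple bool := [tuple g (i : nat)%:Z | i < q].

Let plain (r : int) : q.-tuple bool :=
  word (fun t => if `[< multiple k (r + t) >] then odd k else x (r + t)).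

Let single (s : int) : q.-tuple bool :=
  word (fun t => if t == s then ~~ odd k
                 else if `[< multiple k.+1 (t - s) >] then odd k else x (t - s)).

Let double (s : int) : q.-tuple bool :=
  word (fun t => if (t == s) || (t == s + period k.+1) then ~~ odd k else x (t - s)).

Let special i := multiple k.+1 i /\ x i = ~~ odd k.

Let not_special i : multiple k i -> ~ special i -> x i = odd k.
Proof.
move=> hm hs; have [h|h] := pselect (multiple k.+1 i); last exact: toeplitzE.
by case e : (x i); case ok : (odd k) => //; case: hs; split; rewrite // e ok.
Qed.

Let special_exceptional i j : special i -> ~ multiple k.+1 (j - i) -> x j = x (j - i).
Proof.
move=> [hi _] h; have {1}-> : j = j - i + i by rewrite subrK.
exact: toeplitz_shift hi h.
Qed.

Let past_word e g : (forall t, 0 <= t -> t < q%:Z -> x (e - q%:Z + t) = g t) ->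
  past x e q = word g.
Proof.
move=> h; apply: eq_from_tnth => i; rewrite !tnth_mktuple; apply: h => //.
by rewrite ltz_nat.
Qed.

Let cover e : (exists r : nat, (r%:Z < period k) /\ past x e q = plain r%:Z) \/
  (exists s : nat, (s < q)%N /\ past x e q = single s%:Z) \/
  (exists s : nat, s%:Z + period k.+1 < q%:Z /\ past x e q = double s%:Z).
Proof.
have p0 := period_gt0 k; have p1 := period_gt0 k.+1.
set b := e - q%:Z.
have [hS|hS] := pselect (exists s : nat, (s < q)%N /\ special (b + s%:Z)); last first.
  left; exists (absz (b %% period k)%Z).
  have m1 := ltz_pmod b p0; have m2 := modz_ge0 b (lt0r_neq0 p0).
  have m3 := divz_eq b (period k); split; first lia.
  have -> : (absz (b %% period k)%Z)%:Z = (b %% period k)%Z by lia.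
  set r := (b %% period k)%Z in m1 m2 m3 *.
  apply: past_word => t t0 t1; rewrite -/b.
  have hbr : multiple k (b - r) by exists (b %/ period k)%Z; rewrite {1}m3 addrK.
  have bE : b + t = (r + t) + (b - r) by lia.
  case: asboolP => hm; last by rewrite bE; apply: toeplitz_shift hbr hm.
  apply: not_special; first by rewrite bE; apply: multipleD.
  move=> hs; apply: hS; exists (absz t); split; first lia.
  by have -> : (absz t)%:Z = t by lia.
right; have [s [sq ss] smin] : exists2 s : nat, (s < q)%N /\ special (b + s%:Z) &
    forall s' : nat, special (b + s'%:Z) -> (s <= s')%N.
  have hP : exists s, (s < q)%N && `[< special (b + s%:Z) >].
    by case: hS => s [h1 h2]; exists s; rewrite h1; apply/asboolP.
  case: (ex_minnP hP) => s /andP [h1 /asboolP h2] hmin; exists s => // s' hs'.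
  case: (ltnP s' q) => c; last by apply: leq_trans c; apply: ltnW.
  by apply: hmin; rewrite c; apply/asboolP.
have diff t : b + t - (b + s%:Z) = t - s%:Z by lia.
have [h2|h2] := pselect (special (b + s%:Z + period k.+1) /\ s%:Z + period k.+1 < q%:Z).
  right; exists s; case: h2 => h2 h3; split=> //.
  apply: past_word => t t0 t1; rewrite -/b.
  have [->|ts] := eqVneq t s%:Z; first by case: ss.
  have [->|ts'] := eqVneq t (s%:Z + period k.+1).
    by rewrite orbT addrA; case: h2.
  rewrite -diff; apply: (special_exceptional ss); rewrite diff => -[c ec].
  have [c0|[c1|]] : c <= -1 \/ (c = 0 \/ c = 1) \/ 2 <= c by lia.
  - by have := ltn_ord (ord0 : 'I_1); nia.
  - by case: c1 => c1; rewrite c1 in ec; lia.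
  - by nia.
left; exists s; split=> //; apply: past_word => t t0 t1; rewrite -/b.
have [->|ts] := eqVneq t s%:Z; first by case: ss.
case: asboolP => hm; last by rewrite -diff; apply: (special_exceptional ss); rewrite diff.
have hmb : multiple k.+1 (b + t).
  have -> : b + t = (t - s%:Z) + (b + s%:Z) by lia.
  by apply: multipleD => //; case: ss.
apply: not_special; first exact: multiple_le hmb.
move=> hs; have st : s%:Z <= t.
  have := smin (absz t); have -> : (absz t)%:Z = t by lia.
  by move=> /(_ hs); lia.
case: hm => c ec; have c1 : c = 1.
  have : 0 < c by nia.
  have : c < 2 by nia.
  lia.
apply: h2; rewrite c1 mul1r in ec; split; last lia.
by have -> : b + s%:Z + period k.+1 = b + t by lia.
Qed.

Lemma toeplitz_complexity :
  (nfactors x q)%:Z <= period k + q%:Z + Num.max 0 (q%:Z - period k.+1).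
Proof.
have p0 := period_gt0 k; have p1 := period_gt0 k.+1.
pose a := absz (period k); pose c := absz (Num.max 0 (q%:Z - period k.+1)).
pose F1 (r : 'I_a) := plain (r : nat)%:Z.
pose F2 (r : 'I_q) := single (r : nat)%:Z.
pose F3 (r : 'I_c) := double (r : nat)%:Z.
have sub : factors x q \subset (F1 @: 'I_a) :|: ((F2 @: 'I_q) :|: (F3 @: 'I_c)).
  apply/fintype.subsetP => w; rewrite inE => /asboolP [e ->]; rewrite !finset.in_setU.
  case: (cover e) => [[r [hr ->]]|[[s [hs ->]]|[s [hs ->]]]].
  - have ra : (r < a)%N by lia.
    by apply/orP; left; apply/imsetP; exists (Ordinal ra).
  - by apply/orP; right; apply/orP; left; apply/imsetP; exists (Ordinal hs).
  - have sc : (s < c)%N by lia.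
    by apply/orP; right; apply/orP; right; apply/imsetP; exists (Ordinal sc).
have h := subset_leq_card sub.
have h1 := leq_imset_card F1 'I_a; rewrite card_ord in h1.
have h2 := leq_imset_card F2 'I_q; rewrite card_ord in h2.
have h3 := leq_imset_card F3 'I_c; rewrite card_ord in h3.
have hU (D E : {set q.-tuple bool}) : (#|D :|: E| <= #|D| + #|E|)%N.
  by rewrite cardsU leq_subr.
have : (nfactors x q <= a + (q + c))%N.
  apply: (leq_trans h); apply: leq_trans (hU _ _) _; apply: leq_add h1 _.
  by apply: leq_trans (hU _ _) _; apply: leq_add.
lia.
Qed.

End ToeplitzComplexity.

Lemma toeplitz_limsup_le (R : realType) :
  (limsup_complexity R toeplitz_shiftspace <= (3 / 2)%:E)%E.
Proof.
apply/lee_addgt0Pr => e e0.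
pose K := (Num.truncn e^-1).+1.
have hK : K%:R^-1 <= e.
  rewrite -[leRHS]invrK lef_pV2 ?posrE ?invr_gt0 ?ltr0n //.
  exact/ltW/truncnS_gt.
rewrite /limsup_complexity /limn_esup limf_esupE.
pose V := [set q : nat | period K.+1 <= q%:Z].
apply: (@le_trans _ _ (ereal_sup
  [set ((complexity toeplitz_shiftspace q)%:R / q%:R : R)%:E | q in V])).
  by apply: ereal_inf_lbound; exists V => //; exists (absz (period K.+1)).
apply: ge_ereal_sup => _ [q hq <-]; rewrite lee_fin.
rewrite (complexity_factors toeplitz_minimal toeplitz_in).
have q0 : (0 < q)%N by have := period_gt0 K.+1; rewrite /V /= in hq; lia.
have [k Kk [k1 k2]] : exists2 k, (K <= k)%N & period k.+1 <= q%:Z /\ q%:Z <= period k.+2.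
  have hP : exists k, q%:Z <= period k.+2.
    by exists q; have := period_ge q.+2; lia.
  case: (ex_minnP hP) => k hk hmin.
  have [kK|Kk] := leqP k K.
    exists K => //; split=> //; apply: (le_trans hk).
    exact: period_le.
  exists k; first exact: ltnW.
  split=> //; case: k Kk hk hmin => // k Kk hk hmin.
  by rewrite leNgt; apply/negP => c; have := hmin k (ltW c); lia.
have qR : 0 < q%:R :> R by rewrite ltr0n.
rewrite ler_pdivrMr //.
have p0 := period_gt0 k; have p1 := period_gt0 k.+1.
suff : (2 * k.+2 * nfactors toeplitz q <= (3 * k.+2 + 1) * q)%N.
  move=> h; have {}h : (2 * k.+2%:R * (nfactors toeplitz q)%:R <= (3 * k.+2%:R + 1) * q%:R :> R).
    by rewrite -(ler_nat R) !natrM natrD natrM in h.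
  have k0 : 0 < k.+2%:R :> R by rewrite ltr0n.
  have {}h : (nfactors toeplitz q)%:R <= (3 / 2 + k.+2%:R^-1 / 2) * q%:R :> R.
    rewrite -(ler_pM2l (mulr_gt0 (ltr0n R 2) k0)); apply: (le_trans h).
    by rewrite le_eqVlt; apply/orP; left; apply/eqP; field; rewrite gt_eqF.
  apply: (le_trans h); rewrite ler_pM2r // lerD2l.
  have : k.+2%:R^-1 <= K%:R^-1 :> R.
    by rewrite lef_pV2 ?posrE ?ltr0n // ler_nat; lia.
  have : 0 < k.+2%:R^-1 :> R by rewrite invr_gt0.
  move: (k.+2%:R^-1) (K%:R^-1) hK => y z; lra.
have [c|c] := leP q%:Z (2 * period k.+1).
  have := toeplitz_complexity c; have := periodS k => e1 h.
  rewrite -lez_nat !PoszM PoszD PoszM.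
  have m : k.+2%:Z * (nfactors toeplitz q)%:Z <=
     k.+2%:Z * (period k + q%:Z + Num.max 0 (q%:Z - period k.+1)) by apply: ler_wpM2l.
  have e2 : Num.max 0 (q%:Z - period k.+1) = q%:Z - period k.+1 by lia.
  rewrite e2 in m.
  have m2 : k.+1%:Z * q%:Z <= k.+1%:Z * (2 * period k.+1) by apply: ler_wpM2l.
  lia.
have c2 : q%:Z <= 2 * period k.+2 by lia.
have := toeplitz_complexity c2; have e2 : Num.max 0 (q%:Z - period k.+2) = 0 by lia.
rewrite e2 addr0 => h; rewrite -lez_nat !PoszM PoszD PoszM.
have m : k.+2%:Z * (2 * (nfactors toeplitz q)%:Z) <= k.+2%:Z * (3 * q%:Z).
  by apply: ler_wpM2l => //; lia.
lia.
Qed.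

Section Eigenvalues.
Variable R : realType.

Lemma expiD (a b : R) : expi (a + b) = expi a * expi b.
Proof.
by apply/eqP; rewrite eq_complex /= cosD sinD addrC [_ + sin a * _]addrC !eqxx.
Qed.

Lemma expi_neq0 (a : R) : expi a != 0.
Proof.
apply/eqP => h; have := cos2Dsin2 a.
have [-> ->] : cos a = 0 /\ sin a = 0 by case: h.
by rewrite expr0n addr0 => /eqP; rewrite eq_sym oner_eq0.
Qed.

Lemma cos_doubling (a : R) : (forall n : nat, 0 <= cos (n%:R * a)) -> cos a = 1.
Proof.
move=> h; have grow n : 2 ^+ n * (1 - cos a) <= 1 - cos ((2 ^ n)%:R * a).
  elim: n => [|n IH]; first by rewrite expr0 mul1r expn0 mul1r.
  have -> : (2 ^ n.+1)%:R * a = (2 ^ n)%:R * a + (2 ^ n)%:R * a.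
    by rewrite expnS natrM; ring.
  have := h (2 ^ n)%N; move: ((2 ^ n)%:R * a) IH => b IH b0.
  have e := cos2Dsin2 b; rewrite cosD exprS.
  have := cos_le1 b => b1.
  have : cos b * cos b <= cos b by rewrite ler_piMr.
  have : 0 <= cos b * cos b by rewrite mulr_ge0.
  rewrite !expr2 in e; lra.
apply/eqP; rewrite eq_le cos_le1 /=; rewrite leNgt; apply/negP => c.
have d0 : 0 < 1 - cos a by rewrite subr_gt0.
pose n := (Num.truncn (1 - cos a)^-1).+1.
have hn : 1 < n%:R * (1 - cos a) by rewrite -ltr_pdivrMr // div1r truncnS_gt.
have h2 : n%:R <= 2 ^+ n :> R by rewrite -natrX ler_nat ltnW // ltn_expl.
have := grow n; have := h (2 ^ n)%N.
have : n%:R * (1 - cos a) <= 2 ^+ n * (1 - cos a) by rewrite ler_pM2r.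
lra.
Qed.

Lemma cos_eq1 (a : R) : cos a = 1 -> exists z : int, a = 2 * pi * z%:~R.
Proof.
move=> ca; have p0 : 0 < 2 * pi :> R by rewrite mulr_gt0 // pi_gt0.
pose z := Num.floor (a / (2 * pi)); exists z.
pose r := a - 2 * pi * z%:~R.
have r0 : 0 <= r.
  by rewrite subr_ge0 mulrC -ler_pdivlMr // floor_le_tmp.
have r1 : r < 2 * pi.
  have := floorD1_gt (a / (2 * pi)).
  by rewrite intrD ltr_pdivrMr // mulrDl mul1r mulrC addrC /r ltrBlDr.
have cr : cos r = 1.
  have [<- _] := cos_sin_2pi r z; by rewrite /r subrK.
have [r00|r00] := eqVneq r 0; first by apply/eqP; rewrite -subr_eq0 -/r r00.
have s0 : 0 < sin (r / 2).
  apply: sin_gt0_pi; apply/andP; split; first by rewrite divr_gt0 // lt_def r00.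
  by rewrite ltr_pdivrMr // mulrC.
have := cos2Dsin2 (r / 2); have : cos r = cos (r / 2) ^+ 2 - sin (r / 2) ^+ 2.
  by rewrite {1}(splitr r) cosD !expr2.
have : 0 < sin (r / 2) ^+ 2 by rewrite exprn_gt0.
rewrite cr; lra.
Qed.

Local Notation x := toeplitz.
Local Notation X := toeplitz_shiftspace.

Lemma toeplitz_eigenvalue (gamma : R) : continuous_eigenvalue X gamma ->
  ~ irrational gamma.
Proof.
move=> [f [fc [z0 Xz0 fz0] fe]]; set theta := 2 * pi * gamma in fe.
have orbit i (n : nat) : f (shift_by (i + n%:Z) x) = expi (n%:R * theta) * f (shift_by i x).
  elim: n => [|n IH].
    by rewrite addr0 mul0r /expi cos0 sin0; rewrite -[LHS]mul1r.
  have -> : i + n.+1%:Z = i + n%:Z + 1 by lia.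
  rewrite shift_by_left fe; last exact: toeplitz_shift_in.
  rewrite IH mulrA -expiD; congr (expi _ * _); rewrite -natr1; ring.
have fcont z : X z -> forall e : Cplx R, 0 < e ->
    exists n, forall y, X y -> close_on n z y -> `|f z - f y| < e.
  move=> Xz e e0; have := (subspace_continuousP X f).1 fc z Xz.
  move=> /cvgrPdist_lt /(_ e e0) /cylinder_basis [n hn]; exists n => y Xy hy.
  exact: hn hy Xy.
have fx0 : f x != 0.
  have nz : 0 < `|f z0| by rewrite normr_gt0.
  have [n hn] := fcont _ Xz0 _ nz.
  have [i hi] := Xz0 (- n%:Z) (2 * n%:Z + 1).
  have hcl : close_on n z0 (shift_by (i + n%:Z) x).
    move=> t ht; rewrite /shift_by; have -> : t + (i + n%:Z) = i + (n%:Z + t) by lia.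
    by rewrite hi; [congr z0; lia|lia|lia].
  have nz2 : f (shift_by (i + n%:Z) x) != 0.
    apply/eqP => e0; have := hn _ (toeplitz_shift_in _) hcl.
    by rewrite e0 subr0 ltxx.
  apply: contraNneq nz2 => h0.
  have [->|->] : i + n%:Z = 0 + (absz (i + n%:Z))%:Z \/ i + n%:Z = - (absz (i + n%:Z))%:Z by lia.
    by rewrite orbit shift_by0 h0 mulr0.
  set m := absz _; have := orbit (- m%:Z) m; rewrite addNr shift_by0 h0 => /esym/eqP.
  by rewrite mulf_eq0 (negPf (expi_neq0 _)).
have e0 : 0 < `|f x| / 3 by rewrite divr_gt0 // normr_gt0.
have [n hn] := fcont x toeplitz_in _ e0.
have [k [ek nk]] := even_above n; have pk := period_ge k.
pose L := absz (period k.+1).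
have LE : L%:Z = period k.+1 by have := period_gt0 k.+1; rewrite /L; lia.
have near c : `|f x - f (shift_by (period k + c * period k.+1) x)| < `|f x| / 3.
  apply: hn; first exact: toeplitz_shift_in.
  by move=> t ht; rewrite /shift_by toeplitz_return //; lia.
set y := f (shift_by (period k) x).
have ny : `|f x - y| < `|f x| / 3 by have := near 0; rewrite mul0r addr0.
have powers t : `|1 - expi ((t * L)%:R * theta)| < 1.
  have yE : f (shift_by (period k + t%:Z * period k.+1) x) = expi ((t * L)%:R * theta) * y.
    by rewrite -orbit PoszM LE.
  have h1 := near t%:Z; rewrite yE in h1.
  have y0 : 0 < `|y|.
    rewrite normr_gt0; apply/eqP => y0; move: ny; rewrite y0 subr0.
    have hx : 0 < `|f x| by rewrite normr_gt0.
    have h3 : `|f x| / 3 < `|f x| by rewrite ltr_pdivrMr // ltr_pMr // ltr1n.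
    by move=> /lt_trans /(_ h3); rewrite ltxx.
  rewrite -(ltr_pM2r y0) mul1r -normrM mulrBl mul1r.
  have -> : y - expi ((t * L)%:R * theta) * y =
    (f x - expi ((t * L)%:R * theta) * y) - (f x - y) by ring.
  apply: le_lt_trans (ler_normB _ _) _; apply: (lt_le_trans (ltrD h1 ny)).
  have : `|f x| <= `|y| + `|f x - y| by rewrite -{1}(subrK y (f x)) addrC ler_normD.
  move=> h; have h3 : `|f x| <= `|y| + `|f x| / 3 by apply: (le_trans h); rewrite lerD2l ltW.
  rewrite -(lerD2r (`|f x| / 3)); apply: le_trans h3.
  by rewrite le_eqVlt; apply/orP; left; apply/eqP; field.
have cpos t : 0 <= cos ((t * L)%:R * theta).
  have := powers t; set a := (t * L)%:R * theta => h.
  have : `|1 - cos a| <= 1.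
    have : (`|1 - cos a|)%:C%C <= `|1 - expi a| :> Cplx R.
      have := @normc_ge_Re R (1 - expi a); rewrite /=; exact.
    move=> /le_lt_trans /(_ h); rewrite ltcR; exact: ltW.
  by rewrite ler_norml => /andP [_]; lra.
have c1 : cos (L%:R * theta) = 1.
  by apply: cos_doubling => t; rewrite mulrA -natrM.
have [z hz] := cos_eq1 c1.
have p0 : 0 < 2 * pi :> R by rewrite mulr_gt0 // pi_gt0.
have Lg : L%:R * gamma = z%:~R.
  apply: (mulfI (lt0r_neq0 p0)); rewrite -hz /theta; ring.
have L0 : L%:R != 0 :> R by rewrite pnatr_eq0; have := period_gt0 k.+1; lia.
apply; exists (z%:~R / L%:R) => //.
by rewrite rmorphM /= fmorphV rmorph_int rmorph_nat -Lg mulrC mulKf.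
Qed.

End Eigenvalues.

Theorem corollary1p10 (R : realType) :
  is_minimum
    [set v : \bar R | exists (A : finType) (X : set (fullshift A)),
      [/\ minimal_subshift X,
          infinite_set X,
          ~ (exists2 gamma : R, irrational gamma
               & continuous_eigenvalue X gamma) &
          v = limsup_complexity R X]]
    (3 / 2)%:E.
Proof.
have noeig : ~ (exists2 gamma : R, irrational gamma &
    continuous_eigenvalue toeplitz_shiftspace gamma).
  by move=> [gamma irr /toeplitz_eigenvalue].
split; last by move=> v [A [X [h1 h2 h3 ->]]]; apply: limsup_complexity_lower.
exists bool, toeplitz_shiftspace; split=> //.
- exact: toeplitz_minimal.
- exact: toeplitz_infinite.
- apply/eqP; rewrite eq_le toeplitz_limsup_le andbT.
  apply: limsup_complexity_lower => //; [exact: toeplitz_minimal|exact: toeplitz_infinite].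
Qed.
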